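(* Let $(\zeta(x))_{x>0}$ be the process defined in the context. Then almost surely, for every $0<a<b<\infty$, the total variation of $x\mapsto\zeta(x)$ over $[a,b]$ is finite.
   Context: Let $\mathcal{G}$ be the space of Lipschitz functions $f:\mathbb{R}\to\mathbb{R}$ with the norm $|f(0)|+L_f$, where $L_f=\sup_{x\neq y}|f(y)-f(x)|/|x-y|$, and its Borel $\sigma$-algebra. Let $\nu$ be a probability measure on $\mathcal{G}$, $f$ a random element with distribution $\nu$, and assume $\mathbf{E}L_f<\infty$, $\mathbf{E}\log L_f<0$ and $\mathbf{E}|f(z_0)-z_0|<\infty$ for a fixed $z_0\in\mathbb{R}$. Let $\mathcal{P}$ be a Poisson process on $[0,\infty)\times[0,\infty)\times\mathcal{G}$ with intensity $\mathrm{Leb}\otimes\mathrm{Leb}\otimes\nu$. For $x>0$, enumerate the points $(t_k,x_k,f_k)$ of $\mathcal{P}$ with $x_k\le x$ so that $t_1<t_2<\cdots$, let $N_x(t)$ be the number of them with $t_k\le t$, and set $\zeta_t(x)=f_1\circ\cdots\circ f_{N_x(t)}(z_0)$. Almost surely the limit $\zeta(x)=\lim_{t\to\infty}\zeta_t(x)$ exists simultaneously for all $x>0$ (and does not depend on $z_0$). *)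

(* Defs.v *)
From HB Require Import structures.
From mathcomp Require Import all_boot all_order all_algebra.
From mathcomp Require Import all_classical all_reals all_analysis.
From mathcomp Require Import measurable_realfun.
Set Implicit Arguments. Unset Strict Implicit. Unset Printing Implicit Defensive.
Import Order.TTheory GRing.Theory Num.Theory.
Import numFieldNormedType.Exports.
Local Open Scope classical_set_scope.
Local Open Scope ring_scope.

Section Defs.
Variable R : realType.

Definition is_lipschitz (f : R -> R) : Prop :=
  exists L : R, forall x y, `|f y - f x| <= L * `|y - x|.

Record Lip := MkLip { lip_fun :> R -> R ; lip_lipschitz : is_lipschitz lip_fun }.

Lemma is_lipschitz0 : is_lipschitz (fun _ => 0).
Proof. by exists 0; move=> x y; rewrite subrr normr0 mul0r. Qed.

HB.instance Definition _ := gen_eqMixin Lip.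
HB.instance Definition _ := gen_choiceMixin Lip.
HB.instance Definition _ := isPointed.Build Lip (MkLip is_lipschitz0).

Definition lipconst (f : R -> R) : R :=
  sup [set r | exists x y, x != y /\ r = `|f y - f x| / `|y - x| ].

Definition lipL (f : Lip) : R := lipconst (lip_fun f).

Definition lip_dist (f g : Lip) : R :=
  `|f 0 - g 0| + lipconst (fun x => f x - g x).

Definition lip_open (U : set Lip) : Prop :=
  forall f, U f -> exists2 e : R, 0 < e & forall g, lip_dist f g < e -> U g.

Definition LipG := g_sigma_algebraType lip_open.

(** points (t, x, f) of the Poisson process *)
Definition Pt := ((R * R) * LipG)%type.

Definition quadrant : set Pt := [set p | 0 <= p.1.1 /\ 0 <= p.1.2].

Definition intensity (nu : probability LipG R) : set Pt -> \bar R :=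
  fun A => ((@lebesgue_measure R \x @lebesgue_measure R) \x nu)%E (A `&` quadrant).

Definition poisson_prob (r : R) (k : nat) : R := r ^+ k / k`!%:R * expR (- r).

Definition npoints (S : set Pt) (A : set Pt) : \bar R := counting (S `&` A).

Definition is_poisson_process d (Omega : measurableType d) (P : probability Omega R)
    (S : Omega -> set Pt) (mu : set Pt -> \bar R) : Prop :=
  [/\ (forall A, measurable A ->
        measurable_fun [set: Omega] (fun w => npoints (S w) A : \bar R)),
      (forall A, measurable A -> mu A = +oo%E ->
          P [set w | npoints (S w) A = +oo%E] = 1%E),
      (forall A (k : nat), measurable A -> (mu A < +oo)%E ->
          P [set w | npoints (S w) A = (k%:R)%:E] = (poisson_prob (fine (mu A)) k)%:E)
    & (forall (n : nat) (A : 'I_n -> set Pt) (k : 'I_n -> nat),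
          (forall i, measurable (A i)) ->
          (forall i j, i != j -> A i `&` A j = set0) ->
          fine (P [set w | forall i, npoints (S w) (A i) = ((k i)%:R)%:E]) =
          \prod_(i < n) fine (P [set w | npoints (S w) (A i) = ((k i)%:R)%:E]))].

(** zeta_t(x) = f_1 o ... o f_{N_x(t)} (z0), points ordered by increasing time *)
Definition window (t x : R) : set Pt :=
  [set p | 0 <= p.1.1 <= t /\ 0 <= p.1.2 <= x].

Definition zeta_t (z0 : R) (S : set Pt) (t x : R) : R :=
  foldr (fun (p : Pt) (z : R) => lip_fun p.2 z) z0
    (sort (fun p q : Pt => p.1.1 <= q.1.1) (finmap.enum_fset (fset_set (S `&` window t x)))).

Definition zeta (z0 : R) (S : set Pt) (x : R) : R :=
  lim (zeta_t z0 S t x @[t --> +oo]).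

Definition elog (r : R) : \bar R := if r == 0 then -oo%E else (ln r)%:E.

End Defs.

(* Main.v *)
(* Enlarging x inserts maps into the composition, and only points with
   a < x_k <= b can enter between a and b.  Give a point with x_k <= a the weight
   w_k = L_k and a point with a < x_k <= b the weight w_k = 3 max(L_k, 1).
   By induction along the composition, the increments of zeta_t over [a, b] are
   dominated by those of a nondecreasing function bounded by
   sum_j (prod_{i < j} w_i) |f_j(z_0) - z_0|, so everything reduces to the almost
   sure convergence of this series.

   Since E log L < 0, some s = 1/n has E L^s < 1.  Hence prod L_k over the points
   of [0, m] x [0, a] decays like exp(-c a m), while the product of 3 max(L_k, 1)
   over [0, m] x (a, b] grows at most like exp(c' (b - a) m): both follow from
   E prod g(f_k) = exp(|W| (E g - 1)), Markov's inequality and Borel-Cantelli.  So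
   the series converges as soon as b / a is below some q > 1 that depends only on
   nu, and an arbitrary [a, b] is covered by the intervals
   [q^(k - N), q^(k + 1 - N)]. *)

Require Import Defs.
From HB Require Import structures.
From mathcomp Require Import all_boot all_order all_algebra.
From mathcomp Require Import all_classical all_reals all_analysis.
From mathcomp Require Import measurable_realfun.
From mathcomp Require Import ring lra.
Import Order.TTheory GRing.Theory Num.Theory.
Import numFieldNormedType.Exports.
Local Open Scope classical_set_scope.
Local Open Scope ring_scope.

(** The Poisson process is given by its counts alone, so E prod g(f_k) is not directly at hand for a
    general g. Marks are sorted into finitely many cells by a rounded value of g, the generating
    functions of the independent counts are multiplied, and marks with very large g are avoided
    outside an event of small probability.

    The displacements |f(z_0) - z_0| enter through unit time blocks, each bounded by a product of
    the factors 3 max(L, 1) (1 + |f(z_0) - z_0|). Such a factor need not be integrable, although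
    both of its parts are; its n-th root is integrable as soon as n >= 2. For this reason all
    products are estimated through their n-th roots, with the n of the contraction and n >= 2.

    The composition follows the order of the times, so coinciding times have to be excluded almost
    surely; only then is the ordering compatible with enlarging the window in x and in t. *)

Section Lipschitz.
Context {R : realType}.

Lemma lip_ratios_has_sup (f : R -> R) : is_lipschitz f ->
  has_sup [set r | exists x y, x != y /\ r = `|f y - f x| / `|y - x| ].
Proof.
move=> [L fL]; split.
  by exists (`|f 1 - f 0| / `|1 - 0|); exists 0, 1; rewrite eq_sym oner_neq0.
exists L => _ [x [y [xy ->]]].
by rewrite ler_pdivrMr ?fL// normr_gt0 subr_eq0 eq_sym.
Qed.

Lemma lipconst_le (f : R -> R) : is_lipschitz f ->
  forall x y, `|f y - f x| <= lipconst f * `|y - x|.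
Proof.
move=> fL x y; have [->|xy] := eqVneq x y; first by rewrite !subrr normr0 mulr0.
rewrite -ler_pdivrMr ?normr_gt0 ?subr_eq0 1?eq_sym//.
by apply: ub_le_sup; [exact: (lip_ratios_has_sup _ fL).2|exists x, y].
Qed.

Lemma lipconst_lub (f : R -> R) (K : R) :
  (forall x y, `|f y - f x| <= K * `|y - x|) -> lipconst f <= K.
Proof.
move=> fK; apply: ge_sup.
  by have [] := lip_ratios_has_sup f (ex_intro _ K fK).
move=> _ [x [y [xy ->]]].
by rewrite ler_pdivrMr ?fK// normr_gt0 subr_eq0 eq_sym.
Qed.

Lemma lipconst_ge0 (f : R -> R) : is_lipschitz f -> 0 <= lipconst f.
Proof.
move=> fL; have := lipconst_le _ fL 0 1.
by rewrite subr0 normr1 mulr1; apply: le_trans.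
Qed.

Lemma is_lipschitzB (f g : R -> R) :
  is_lipschitz f -> is_lipschitz g -> is_lipschitz (fun x => f x - g x).
Proof.
move=> [K fK] [L gL]; exists (K + L) => x y.
have -> : f y - g y - (f x - g x) = (f y - f x) - (g y - g x) by ring.
by rewrite mulrDl (le_trans (ler_normB _ _))// lerD.
Qed.

Lemma lipL_ge0 (f : Lip R) : 0 <= lipL f.
Proof. by apply: lipconst_ge0; exact: lip_lipschitz. Qed.

Lemma lipL_le (f : Lip R) x y : `|f y - f x| <= lipL f * `|y - x|.
Proof. by apply: lipconst_le; exact: lip_lipschitz. Qed.

Lemma lipL_sub_le (f g : Lip R) : lipL f <= lipL g + lip_dist f g.
Proof.
have fgL := is_lipschitzB _ _ (lip_lipschitz f) (lip_lipschitz g).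
apply: lipconst_lub => x y.
have -> : f y - f x = (g y - g x) + ((f y - g y) - (f x - g x)).
  by ring.
rewrite (le_trans (ler_normD _ _))// mulrDl lerD ?lipL_le//.
rewrite (le_trans (lipconst_le _ fgL x y))// ler_wpM2r// lerDr.
by rewrite normr_ge0.
Qed.

Lemma eval_sub_le (z : R) (f g : Lip R) :
  `|f z - g z| <= (1 + `|z|) * lip_dist f g.
Proof.
have fgL := is_lipschitzB _ _ (lip_lipschitz f) (lip_lipschitz g).
have -> : f z - g z = (f 0 - g 0) + ((f z - g z) - (f 0 - g 0)).
  by ring.
rewrite (le_trans (ler_normD _ _))// /lip_dist mulrDl mul1r.
rewrite (le_trans (lerD (lexx _) (lipconst_le _ fgL 0 z)))// subr0 mulrDr.
set A := `|_|; set B := lipconst _; set Z := `|z|.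
have ? : 0 <= A by exact: normr_ge0.
have ? : 0 <= B by exact: lipconst_ge0.
have ? : 0 <= Z by exact: normr_ge0.
by nra.
Qed.

(** The superlevel sets of [h] are open for [lip_dist], and the rays ]r, +oo[ generate the Borel
    sets of the line. It serves for L_f and for |f(z) - z|. *)
Lemma measurable_lip_continuous (h : LipG R -> R) (K : R) :
  (forall f g : Lip R, h f <= h g + K * lip_dist f g) ->
  measurable_fun [set: LipG R] h.
Proof.
move=> hK; apply: (measurability _ (RGenOInfty.measurableE R)) => _ [_ [r ->] <-].
rewrite setTI; apply: sub_sigma_algebra => f /=; rewrite in_itv/= andbT => rf.
exists ((h f - r) / (`|K| + 1)); first by rewrite divr_gt0 ?subr_gt0 ?ltr_wpDl.
move=> g fg; rewrite in_itv/= andbT.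
have d0 : 0 <= lip_dist f g.
  by rewrite addr_ge0// lipconst_ge0//; apply: is_lipschitzB; exact: lip_lipschitz.
have := hK f g; rewrite -lerBlDr; apply: lt_le_trans.
rewrite ltrBrDr addrC -ltrBrDr.
have /le_lt_trans : K * lip_dist f g <= (`|K| + 1) * lip_dist f g.
  by rewrite ler_wpM2r// (le_trans (ler_norm _))// lerDl.
by apply; rewrite mulrC -ltr_pdivlMr// ltr_wpDl.
Qed.

Lemma measurable_lipL : measurable_fun [set: LipG R] (@lipL R : LipG R -> R).
Proof.
by apply: (measurable_lip_continuous _ 1) => f g; rewrite mul1r lipL_sub_le.
Qed.

Lemma measurable_displacement (z : R) :
  measurable_fun [set: LipG R] (fun f : LipG R => `|lip_fun f z - z|).
Proof.
apply: (measurable_lip_continuous _ (1 + `|z|)) => f g.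
have -> : f z - z = (g z - z) + (f z - g z) by ring.
by rewrite (le_trans (ler_normD _ _))// lerD2l eval_sub_le.
Qed.

End Lipschitz.

(** * Deterministic domination of the compositions *)

Section Domination.
Context {R : realType}.
Variables (z0 a : R).
Implicit Types (p q : Pt R) (l : seq (Pt R)) (x y : R).

Definition displacement p : R := `|lip_fun p.2 z0 - z0|.

Definition inflated_lip p : R := 3 * Num.max (lipL p.2) 1.

Definition slope p : R := if p.1.2 <= a then lipL p.2 else inflated_lip p.

Definition below x p : bool := p.1.2 <= x.

Definition compose_maps l : R := foldr (fun p z => lip_fun p.2 z) z0 l.

(** Horner form of the series sum_j (prod_{i < j} w_i) |f_j(z_0) - z_0|, suited to induction along
    the composition. *)
Definition majorant l : R := foldr (fun p h => displacement p + slope p * h) 0 l.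

Lemma displacement_ge0 p : 0 <= displacement p.
Proof. by rewrite normr_ge0. Qed.

Lemma inflated_lip_ge1 p : 1 <= inflated_lip p.
Proof.
have : 1 <= Num.max (lipL p.2) 1 by rewrite le_max lexx orbT.
by rewrite /inflated_lip; lra.
Qed.

Lemma inflated_lip_ge p : 3 * lipL p.2 <= inflated_lip p.
Proof. by rewrite ler_pM2l// le_max lexx. Qed.

Lemma slope_le_inflated p : slope p <= inflated_lip p.
Proof.
rewrite /slope; case: ifP => // _.
by have := inflated_lip_ge p; have := lipL_ge0 p.2; lra.
Qed.

Lemma lip_le_slope p : lipL p.2 <= slope p.
Proof.
rewrite /slope; case: ifP => // _.
by have := inflated_lip_ge p; have := lipL_ge0 p.2; lra.
Qed.

Lemma slope_ge0 p : 0 <= slope p.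
Proof. exact: le_trans (lipL_ge0 p.2) (lip_le_slope p). Qed.

Lemma slope_gt p : a < p.1.2 -> slope p = inflated_lip p.
Proof. by rewrite /slope leNgt => ->. Qed.

Lemma majorant_ge0 l : 0 <= majorant l.
Proof.
by elim: l => //= p l ih; rewrite addr_ge0 ?displacement_ge0 ?mulr_ge0 ?slope_ge0.
Qed.

Lemma majorant_cat l l' :
  majorant (l ++ l') = majorant l + (\prod_(p <- l) slope p) * majorant l'.
Proof.
elim: l => [|p l ih] /=; first by rewrite big_nil mul1r add0r.
by rewrite ih big_cons; ring.
Qed.

(** An inserted point lies above [a], so its slope is at least 1 and h <= B + slope h. The maximum
    with 1 in [inflated_lip] is there for this. *)
Lemma majorant_below_le l x y : a <= x -> x <= y ->
  majorant [seq p <- l | below x p] <= majorant [seq p <- l | below y p].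
Proof.
move=> ax xy; elim: l => //= p l ih; rewrite [below x p]/below [below y p]/below.
have [px|px] := leP p.1.2 x; first by rewrite (le_trans px xy)/= lerD2l ler_wpM2l ?slope_ge0.
have [py|//] := leP p.1.2 y; rewrite /= (le_trans ih)//.
have k1 : 1 <= slope p.
  by rewrite slope_gt ?(le_lt_trans ax px)// inflated_lip_ge1.
rewrite (le_trans (_ : _ <= slope p * majorant [seq p <- l | below y p]))//.
  by rewrite ler_peMl ?majorant_ge0.
by rewrite lerDr displacement_ge0.
Qed.

Lemma majorant_below_le_all l x : a <= x ->
  majorant [seq p <- l | below x p] <= majorant l.
Proof.
move=> ax; elim: l => //= p l ih; rewrite [below x p]/below.
have [px|px] := leP p.1.2 x; first by rewrite /= lerD2l ler_wpM2l ?slope_ge0.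
rewrite (le_trans ih)//.
have k1 : 1 <= slope p.
  by rewrite slope_gt ?(le_lt_trans ax px)// inflated_lip_ge1.
rewrite (le_trans (_ : _ <= slope p * majorant l))//.
  by rewrite ler_peMl ?majorant_ge0.
by rewrite lerDr displacement_ge0.
Qed.

Lemma prod_lip_below_le l x : a <= x ->
  \prod_(p <- [seq p <- l | below x p]) lipL p.2 <= \prod_(p <- l) slope p.
Proof.
move=> ax; elim: l => [|p l ih] /=; first by rewrite !big_nil.
rewrite big_cons [below x p]/below; have [px|px] := leP p.1.2 x.
  rewrite big_cons ler_pM ?lipL_ge0 ?lip_le_slope//.
  by apply: prodr_ge0 => q _; exact: lipL_ge0.
rewrite (le_trans ih)// ler_peMl//.
  by apply: prodr_ge0 => q _; exact: slope_ge0.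
by rewrite slope_gt ?(le_lt_trans ax px)// inflated_lip_ge1.
Qed.

Lemma lip_dist_base_le p (z h : R) : `|z - z0| <= h ->
  `|lip_fun p.2 z - z0| <= displacement p + lipL p.2 * h.
Proof.
move=> zh; rewrite -(subrKA (lip_fun p.2 z0)) addrC.
rewrite (le_trans (ler_normD _ _))// lerD// (le_trans (lipL_le _ _ _))//.
by rewrite ler_wpM2l ?lipL_ge0.
Qed.

Lemma compose_maps_dist_base_le l : `|compose_maps l - z0| <= majorant l.
Proof.
elim: l => [|p l ih] /=; first by rewrite subrr normr0.
rewrite (le_trans (lip_dist_base_le p _ _ ih))// lerD2l.
by rewrite ler_wpM2r ?lip_le_slope// majorant_ge0.
Qed.

(* When the point [p] appears between [x] and [y], the jump is at most
   [B + L H(y) + H(x) <= (B + 3 max(L, 1) H(y)) - H(x)]: the factor 3 in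
   [inflated_lip] is there for this step. *)
Lemma compose_maps_below_le l x y : a <= x -> x <= y ->
  `|compose_maps [seq p <- l | below y p]
    - compose_maps [seq p <- l | below x p]| <=
  majorant [seq p <- l | below y p] - majorant [seq p <- l | below x p].
Proof.
move=> ax xy; elim: l => [|p l ih] /=; first by rewrite !subrr normr0.
have Hxy := majorant_below_le l _ _ ax xy.
move: ih Hxy; rewrite [below x p]/below [below y p]/below.
set Fx := compose_maps [seq p <- l | below x p].
set Fy := compose_maps [seq p <- l | below y p].
have HFx : `|Fx - z0| <= _ := compose_maps_dist_base_le _.
have HFy : `|Fy - z0| <= _ := compose_maps_dist_base_le _.
move: HFx HFy.
set Hx := majorant [seq p <- l | below x p].
set Hy := majorant [seq p <- l | below y p].
move=> HFx HFy ih Hxy.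
(* For a point present on both sides, the displacement cancels between the two majorants and the
   increment is multiplied by at most L <= slope. *)
have [px|px] := leP p.1.2 x.
  rewrite (le_trans px xy)/= opprD addrACA subrr add0r -mulrBr.
  rewrite (le_trans (lipL_le _ _ _))// (le_trans (ler_wpM2l (lipL_ge0 _) ih))//.
  by rewrite ler_wpM2r ?subr_ge0// lip_le_slope.
have [py|//] := leP p.1.2 y; rewrite /=.
rewrite -/(compose_maps _) -/Fy -/Fx -(subrKA z0).
rewrite (le_trans (ler_normD _ _))// [X in _ + X]distrC.
have := lip_dist_base_le p _ _ HFy.
rewrite slope_gt ?(le_lt_trans ax px)//.
have Hx0 : 0 <= Hx by exact: majorant_ge0.
rewrite /inflated_lip; have : lipL p.2 <= Num.max (lipL p.2) 1 by rewrite le_max lexx.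
have : 1 <= Num.max (lipL p.2) 1 by rewrite le_max lexx orbT.
rewrite -/(majorant _) -/Hx -/Hy.
set M := Num.max _ _; set L := lipL _ => M1 LM fF.
have : L * Hy <= M * Hy by rewrite ler_wpM2r// (le_trans Hx0).
have : 0 <= (M - 1) * Hy by rewrite mulr_ge0 ?subr_ge0// (le_trans Hx0).
by nra.
Qed.

(** Later maps sit at the inner end, so the two compositions apply the same maps of [l] to different
    starting points. The bound does not involve [x], which makes the convergence in t uniform over x
    >= a. *)
Lemma compose_maps_cat_le l l' x : a <= x ->
  `|compose_maps [seq p <- l ++ l' | below x p]
    - compose_maps [seq p <- l | below x p]| <=
  majorant (l ++ l') - majorant l.
Proof.
move=> ax; rewrite filter_cat majorant_cat addrAC subrr add0r.
have H' : `|compose_maps [seq p <- l' | below x p] - z0| <= majorant l'.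
  by rewrite (le_trans (compose_maps_dist_base_le _))// majorant_below_le_all.
rewrite (le_trans (_ : _ <= (\prod_(p <- [seq p <- l | below x p]) lipL p.2)
    * majorant l'))//; last first.
  by rewrite ler_wpM2r ?majorant_ge0// prod_lip_below_le.
rewrite /compose_maps foldr_cat -/(compose_maps [seq p <- l' | below x p]).
elim: [seq p <- l | below x p] => [|p s ih] /=; first by rewrite big_nil mul1r.
rewrite big_cons -mulrA (le_trans (lipL_le _ _ _))//.
by rewrite ler_wpM2l ?lipL_ge0.
Qed.

(** One step is 1 + B + k h <= M (1 + B) (1 + h), for k <= M and M >= 1. Trading the sum for a
    product makes a block of points accessible to the same moment bound as the slopes. *)
Lemma majorant_le_prod l :
  1 + majorant l <= \prod_(p <- l) (inflated_lip p * (1 + displacement p)).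
Proof.
elim: l => [|p l ih] /=; first by rewrite big_nil addr0.
rewrite big_cons; apply: le_trans (ler_wpM2l _ ih); last first.
  by rewrite mulr_ge0 ?addr_ge0 ?displacement_ge0// (le_trans ler01)// inflated_lip_ge1.
have := displacement_ge0 p; have := inflated_lip_ge1 p; have := slope_ge0 p.
have := slope_le_inflated p; have := majorant_ge0 l.
rewrite -/(majorant l).
move: (majorant l) (slope p) (inflated_lip p) (displacement p) => h k M B.
move=> h0 kM k0 M1 B0; have : k * h <= M * h by rewrite ler_wpM2r.
have : 0 <= M * h * B by rewrite !mulr_ge0//; lra.
have : 0 <= (M - 1) * B by rewrite mulr_ge0//; lra.
by nra.
Qed.

End Domination.

(** [fset_set] sends an infinite set to the empty one, so a bound on a product over this list is
    informative only along with finiteness of the set. *)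
Definition points {R : realType} (A : set (Pt R)) : seq (Pt R) :=
  finmap.enum_fset (fset_set A).

(** * The maps in order of time, and the limit t -> +oo *)

Section Timeline.
Context {R : realType}.
Variables (z0 : R) (S : set (Pt R)) (b : R).
Implicit Types (p q : Pt R) (t x : R).

Hypothesis finite_window : forall t, finite_set (S `&` window t b).
Hypothesis distinct_times : forall t p q, (S `&` window t b) p ->
  (S `&` window t b) q -> p.1.1 = q.1.1 -> p = q.

Definition timeline t x : seq (Pt R) :=
  sort (fun p q => p.1.1 <= q.1.1) (points (S `&` window t x)).

Let before p q := p.1.1 < q.1.1.

Lemma before_trans : transitive before.
Proof. by move=> q p r; exact: lt_trans. Qed.

Lemma before_irr : irreflexive before.
Proof. by move=> p; rewrite /before ltxx. Qed.

Lemma window_le t x t' x' : t <= t' -> x <= x' -> window t x `<=` window t' x'.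
Proof.
move=> tt' xx' p [/andP[p0 pt] /andP[q0 qx]].
by split; [rewrite p0 (le_trans pt)|rewrite q0 (le_trans qx)].
Qed.

Lemma finite_window_le t x : x <= b -> finite_set (S `&` window t x).
Proof. by move=> xb; apply: sub_finite_set (finite_window t); apply: setIS; apply: window_le. Qed.

Lemma mem_timeline t x p : x <= b ->
  (p \in timeline t x) = (p \in S `&` window t x).
Proof.
by move=> xb; rewrite mem_sort; apply: in_fset_set; exact: finite_window_le.
Qed.

Lemma timeline_uniq t x : uniq (timeline t x).
Proof. by rewrite sort_uniq finmap.fset_uniq. Qed.

Lemma timeline_sorted t x : x <= b -> sorted before (timeline t x).
Proof.
move=> xb; set time := fun p : Pt R => p.1.1.
have les : sorted <=%R (map time (timeline t x)).
  by rewrite sorted_map; apply: sort_sorted => p q; exact: le_total.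
suff : sorted <%R (map time (timeline t x)) by rewrite sorted_map.
rewrite lt_sorted_uniq_le les andbT map_inj_in_uniq ?timeline_uniq// => p q.
rewrite !mem_timeline// => /set_mem[Sp wp] /set_mem[Sq wq].
by apply: (distinct_times t); split=> //; [move: wp|move: wq]; apply: window_le.
Qed.

(** Strictly sorted lists with the same members are equal. Distinct times give the strictness: ties
    would be resolved by [sort] according to the enumeration of the set, which may change with
    [x]. *)
Lemma timeline_below t x : x <= b -> timeline t x = [seq p <- timeline t b | below x p].
Proof.
move=> xb; apply: (irr_sorted_eq before_trans before_irr).
- exact: timeline_sorted.
- by apply: sorted_filter; [exact: before_trans|exact: timeline_sorted].
move=> p; rewrite mem_filter !mem_timeline//; apply/idP/idP.
  move=> /set_mem[Sp wp]; apply/andP; split; first by case: wp => _ /andP[].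
  by apply/mem_set; split=> //; move: wp; apply: window_le.
move=> /andP[px /set_mem[Sp [tp /andP[p0 pb]]]].
by apply/mem_set; do !split=> //; rewrite p0.
Qed.

Lemma timeline_split t t' : t <= t' ->
  timeline t' b = timeline t b ++ [seq p <- timeline t' b | t < p.1.1].
Proof.
move=> tt'; apply: (irr_sorted_eq before_trans before_irr).
- exact: timeline_sorted.
- rewrite (sorted_pairwise before_trans) pairwise_cat.
  rewrite -!(sorted_pairwise before_trans) timeline_sorted//=.
  rewrite sorted_filter ?timeline_sorted ?andbT//; last exact: before_trans.
  apply/allrelP => p q; rewrite mem_timeline// mem_filter.
  move=> /set_mem[_ [/andP[_ pt] _]] /andP[tq _]; exact: le_lt_trans tq.
move=> p; rewrite mem_cat mem_filter !mem_timeline//; apply/idP/idP.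
  move=> /[dup] pS /set_mem[Sp [/andP[p0 pt'] px]]; case: (leP p.1.1 t) => pt /=.
    by rewrite orbF; apply/mem_set; split=> //; split=> //; rewrite p0.
  by rewrite pS orbT.
move=> /orP[|/andP[]//] /set_mem[Sp wp].
by apply/mem_set; split=> //; move: wp; apply: window_le.
Qed.

Lemma zeta_tE t x : x <= b ->
  zeta_t z0 S t x = compose_maps z0 [seq p <- timeline t b | below x p].
Proof. by move=> xb; rewrite -timeline_below. Qed.

Variable a : R.
Hypothesis ab : a < b.

Lemma zeta_t_variation t x y : a <= x -> x <= y -> y <= b ->
  `|zeta_t z0 S t y - zeta_t z0 S t x| <=
  majorant z0 a [seq p <- timeline t b | below y p]
  - majorant z0 a [seq p <- timeline t b | below x p].
Proof.
move=> ax xy yb; rewrite !zeta_tE ?(le_trans xy)//.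
exact: compose_maps_below_le.
Qed.

Lemma zeta_t_sub_le t t' x : a <= x -> x <= b -> t <= t' ->
  `|zeta_t z0 S t' x - zeta_t z0 S t x| <=
  majorant z0 a (timeline t' b) - majorant z0 a (timeline t b).
Proof.
move=> ax xb tt'; rewrite !zeta_tE// (timeline_split _ _ tt').
exact: compose_maps_cat_le.
Qed.

(** The hypothesis makes [g] nondecreasing on [a, b], so the variation of [g] telescopes. *)
Lemma variation_domination (f g : R -> R) (s : seq R) :
  (forall x y, a <= x -> x <= y -> y <= b -> `|f y - f x| <= g y - g x) ->
  itv_partition a b s -> variation a b f s <= g b - g a.
Proof.
move=> fg abs; have ndg : {in `[a, b] &, {homo g : n m / n <= m}}.
  move=> x y; rewrite !in_itv/= => /andP[ax _] /andP[_ yb] xy.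
  by rewrite -subr_ge0 (le_trans _ (fg _ _ ax xy yb)).
rewrite -(nondecreasing_variation ndg abs) /variation !big_nat.
apply: ler_sum => n /andP[_ ns].
apply: le_trans (ler_norm _); apply: fg.
- by apply: (itv_partition_nth_ge _ abs); exact: ltnW.
- exact: (@nondecreasing_fun_itv_partition _ _ _ _ id _ (fun _ _ _ _ => id) abs n ns).
- exact: (itv_partition_nth_le _ abs).
Qed.

Lemma zeta_bounded_variation (M : R) :
  (forall m : nat, majorant z0 a (timeline m%:R b) <= M) ->
  (total_variation a b (zeta z0 S) < +oo)%E.
Proof.
move=> PsiM; pose Psi t := majorant z0 a (timeline t b).
(* At [x = a] the increment of [Psi] dominates an absolute value, hence is nonnegative. *)
have ndPsi : {homo Psi : t t' / t <= t'}.
  move=> t t' tt'; rewrite -subr_ge0.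
  exact: le_trans (zeta_t_sub_le _ _ _ (lexx a) (ltW ab) tt').
have PsiM' t : Psi t <= M.
  apply: le_trans (PsiM (Num.trunc `|t|).+1); apply: ndPsi.
  rewrite (le_trans (ler_norm t))//.
  by have /andP[_ /ltW] := truncn_itv (normr_ge0 t).
(* [Psi] is monotone and bounded, so from some [t0] on it stays within [e] of its supremum; its
   increments dominate those of [zeta_t], which is therefore Cauchy. *)
have cvz x : a <= x -> x <= b -> zeta_t z0 S t x @[t --> +oo] --> zeta z0 S x.
  move=> ax xb; apply/cauchy_cvgP; apply: cauchy_exP => e e0.
  have hs : has_sup (range Psi) by split; [exists (Psi 0), 0|exists M => _ [t _ <-]].
  have [_ [t0 _ <-] lt0] := sup_adherent e0 hs.
  exists (zeta_t z0 S t0 x); exists t0; split; first exact: num_real.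
  move=> t /ltW t0t; rewrite /ball/= distrC (le_lt_trans (zeta_t_sub_le _ _ _ ax xb t0t))//.
  rewrite ltrBlDr -ltrBlDl; apply: le_lt_trans lt0; rewrite lerB//.
  by apply: (sup_upper_bound hs); exists t.
have : bounded_variation a b (zeta z0 S).
  exists M => _ [s abs <-].
  pose u i := nth b (a :: s) i.
  pose v (f : R -> R) : R := \sum_(i < size s) `|f (u i.+1) - f (u i)|.
  have vE f : variation a b f s = v f by rewrite /variation big_mkord.
  (* Along a fixed partition the variation is a finite sum, so it passes to the pointwise limit, and
     the bound [M], uniform in t, survives. *)
  have cvs : v (zeta_t z0 S t) @[t --> +oo] --> v (zeta z0 S).
    apply: (@cvg_big _ _ +%R 0 xpredT add_continuous) => i _.
    have uab k : (k <= size s)%N -> a <= u k <= b.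
      by move=> ks; rewrite (itv_partition_nth_ge _ abs)// (itv_partition_nth_le _ abs).
    have /andP[? ?] := uab i (ltnW (ltn_ord i)).
    have /andP[? ?] := uab i.+1 (ltn_ord i).
    by apply: cvg_norm; apply: cvgB; apply: cvz.
  rewrite vE; apply: (cvgr_to_le cvs).
  apply: nearW => t; rewrite -vE (le_trans (variation_domination _ _ _ (zeta_t_variation t) abs))//.
  rewrite lerBlDr (le_trans (majorant_below_le_all _ _ _ _ (ltW ab)))//.
  by rewrite (le_trans (PsiM' t))// lerDl majorant_ge0.
by move/(bounded_variationP _ (ltW ab)) => /fin_numPlt /andP[].
Qed.

End Timeline.

(** * Growth of the majorant over unit time steps *)

Section MajorantBound.
Context {R : realType}.
Variables (z0 : R) (S : set (Pt R)) (a b : R).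
Hypothesis finite_window : forall t, finite_set (S `&` window t b).
Hypothesis distinct_times : forall t p q, (S `&` window t b) p ->
  (S `&` window t b) q -> p.1.1 = q.1.1 -> p = q.
Hypothesis ab : 0 < a < b.

Definition strip (I J : interval R) : set (Pt R) :=
  [set p | p.1.1 \in I /\ p.1.2 \in J].

Lemma timeline_filter_perm (Q : pred (Pt R)) (U : set (Pt R)) t :
  (forall p, U p <-> window t b p /\ Q p) ->
  perm_eq [seq p <- timeline S t b | Q p] (points (S `&` U)).
Proof.
move=> UQ; apply: uniq_perm; first exact/filter_uniq/timeline_uniq.
  exact: finmap.fset_uniq.
have finU : finite_set (S `&` U).
  by apply: sub_finite_set (finite_window t) => p [Sp /UQ[]].
move=> p; rewrite mem_filter (mem_timeline _ _ finite_window)//.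
rewrite [RHS](in_fset_set finU); apply/idP/idP.
  by move=> /andP[Qp /set_mem[Sp wp]]; apply/mem_set; split=> //; apply/UQ.
by move=> /set_mem[Sp /UQ[wp ->]]; apply/mem_set.
Qed.

Lemma prod_slope_timeline t :
  \prod_(p <- timeline S t b) slope a p =
  (\prod_(p <- points (S `&` strip `[0, t] `[0, a])) lipL p.2) *
  \prod_(p <- points (S `&` strip `[0, t] `]a, b])) inflated_lip p.
Proof.
have /andP[a0 ab'] := ab.
rewrite (bigID (fun p : Pt R => p.1.2 <= a))/=; congr (_ * _).
  rewrite (eq_bigr (fun p : Pt R => lipL p.2)); last by move=> p; rewrite /slope => ->.
  rewrite -big_filter; apply: perm_big; apply: timeline_filter_perm => p.
  rewrite /strip/= !in_itv/= /window/=; split.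
    by move=> [-> /andP[-> /[dup] pa ->]]; rewrite (le_trans pa (ltW ab')).
  by move=> [[-> /andP[-> _]] ->].
rewrite (eq_bigr (@inflated_lip R)); last first.
  by move=> p; rewrite -ltNge; exact: slope_gt.
rewrite -big_filter; apply: perm_big; apply: timeline_filter_perm => p.
rewrite /strip/= !in_itv/= /window/= -ltNge; split.
  by move=> [-> /andP[/[dup] pa -> ->]]; rewrite (ltW (lt_trans a0 pa)).
by move=> [[-> /andP[_ ->]] ->].
Qed.

Lemma majorant_timeline_step t t' : 0 <= t -> t <= t' ->
  majorant z0 a (timeline S t' b) <= majorant z0 a (timeline S t b) +
  (\prod_(p <- points (S `&` strip `[0, t] `[0, a])) lipL p.2) *
  (\prod_(p <- points (S `&` strip `[0, t] `]a, b])) inflated_lip p) *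
  \prod_(p <- points (S `&` strip `]t, t'] `[0, b]))
     (inflated_lip p * (1 + displacement z0 p)).
Proof.
move=> t0 tt'; rewrite [in leLHS](timeline_split _ _ finite_window distinct_times _ _ tt').
rewrite majorant_cat lerD2l -prod_slope_timeline ler_wpM2l//.
  by apply: prodr_ge0 => p _; exact: slope_ge0.
have -> : \prod_(p <- points (S `&` strip `]t, t'] `[0, b]))
     (inflated_lip p * (1 + displacement z0 p)) =
    \prod_(p <- [seq p <- timeline S t' b | t < p.1.1])
     (inflated_lip p * (1 + displacement z0 p)).
  apply/esym/perm_big/timeline_filter_perm => p.
  rewrite /strip/= !in_itv/= /window/=; split.
    by move=> [/andP[/[dup] pt -> ->] ->]; rewrite (ltW (le_lt_trans t0 pt)).
  by move=> [[/andP[_ ->] ->] ->].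
by rewrite (le_trans _ (majorant_le_prod _ a _))// lerDr.
Qed.

(** Here [c1] is the contraction rate below [a], [c2] the growth rate between [a] and [b], and [c3]
    the rate granted to a unit time block. From [N] on, the increments are at most r^m with r =
    exp(c2 + c3 - c1) < 1. *)
Lemma majorant_timeline_bounded (c1 c2 c3 : R) (N : nat) :
  c2 + c3 < c1 ->
  (forall m : nat, (N <= m)%N -> [/\
    \prod_(p <- points (S `&` strip `[0, m%:R] `[0, a])) lipL p.2 <= expR (- c1) ^+ m,
    \prod_(p <- points (S `&` strip `[0, m%:R] `]a, b])) inflated_lip p <= expR c2 ^+ m &
    \prod_(p <- points (S `&` strip `]m%:R, m.+1%:R] `[0, b]))
     (inflated_lip p * (1 + displacement z0 p)) <= expR c3 ^+ m]) ->
  exists M, forall m : nat, majorant z0 a (timeline S m%:R b) <= M.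
Proof.
move=> c123 H; set Psi := fun m : nat => majorant z0 a (timeline S m%:R b).
pose r := expR (c2 + c3 - c1).
have r0 : 0 < r by exact: expR_gt0.
have r1 : r < 1 by rewrite -expR0 ltr_expR subr_lt0.
have step m : (N <= m)%N -> Psi m.+1 <= Psi m + r ^+ m.
  move=> /H[H1 H2 H3]; have mm : (m%:R : R) <= m.+1%:R by rewrite ler_nat.
  apply: (le_trans (majorant_timeline_step _ _ (ler0n _ _) mm)).
  rewrite lerD2l /r (_ : c2 + c3 - c1 = - c1 + c2 + c3); last by ring.
  rewrite !expRD !exprMn; apply: ler_pM => //.
  - rewrite mulr_ge0//; apply: prodr_ge0 => p _; first exact: lipL_ge0.
    by rewrite (le_trans ler01)// inflated_lip_ge1.
  - apply: prodr_ge0 => p _; rewrite mulr_ge0//.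
      by rewrite (le_trans ler01)// inflated_lip_ge1.
    by rewrite addr_ge0// displacement_ge0.
  - apply: ler_pM => //; apply: prodr_ge0 => p _; first exact: lipL_ge0.
    by rewrite (le_trans ler01)// inflated_lip_ge1.
have nd m n : (m <= n)%N -> Psi m <= Psi n.
  move=> mn; have mn' : (m%:R : R) <= n%:R by rewrite ler_nat.
  rewrite /Psi [in leRHS](timeline_split _ _ finite_window distinct_times _ _ mn').
  rewrite majorant_cat lerDl mulr_ge0 ?majorant_ge0//.
  by apply: prodr_ge0 => p _; exact: slope_ge0.
(* Adding the remaining geometric tail r^m / (1 - r) to [Psi m] gives a quantity that does not
   increase. *)
have inv k : Psi (N + k)%N + r ^+ (N + k) / (1 - r) <= Psi N + r ^+ N / (1 - r).
  elim: k => [|k ih]; first by rewrite addn0.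
  apply: le_trans ih; rewrite addnS.
  apply: (le_trans (lerD (step _ (leq_addr _ _)) (lexx _))).
  rewrite -addrA lerD2l exprS le_eqVlt; apply/orP; left; apply/eqP.
  by field; rewrite subr_eq0 gt_eqF.
exists (Psi N + r ^+ N / (1 - r)) => m.
apply: le_trans (inv m); rewrite (le_trans (nd _ _ (leq_addl N m)))// lerDl.
by rewrite divr_ge0 ?subr_ge0 ?(ltW r1)// exprn_ge0// ltW.
Qed.

End MajorantBound.

(** * Poisson counts and their joint generating function *)

Section PoissonCounts.
Context {R : realType} {d : measure_display} {Omega : measurableType d}.
Variables (P : probability Omega R) (S : Omega -> set (Pt R)).
Variable mu : set (Pt R) -> \bar R.
Hypothesis poissonS : is_poisson_process P S mu.
Hypothesis mu_ge0 : forall A, (0 <= mu A)%E.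
Implicit Types (A : set (Pt R)) (w : Omega).

Definition num_points A w : nat := size (points (S w `&` A)).

Lemma npointsP A w (k : nat) :
  npoints (S w) A = (k%:R)%:E <-> finite_set (S w `&` A) /\ num_points A w = k.
Proof.
rewrite /npoints /counting; case: asboolP => [fin|nfin]; last by split=> // -[].
split=> [[/eqP]|[_ <-]//].
by rewrite eqr_nat => /eqP.
Qed.

Lemma measurable_npoints A : measurable A ->
  measurable_fun [set: Omega] (fun w => npoints (S w) A).
Proof. by case: poissonS => + _ _ _; exact. Qed.

Lemma measurable_count_eq A (k : nat) : measurable A ->
  measurable [set w | npoints (S w) A = (k%:R)%:E].
Proof.
move=> mA; rewrite -[X in measurable X]setTI.
exact: (measurable_npoints _ mA measurableT [set (k%:R)%:E] (emeasurable_set1 _)).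
Qed.

Lemma measurable_finite A : measurable A ->
  measurable [set w | finite_set (S w `&` A)].
Proof.
move=> mA; rewrite (_ : [set w | _] = \bigcup_k [set w | npoints (S w) A = (k%:R)%:E]).
  by apply: bigcupT_measurable => k; exact: measurable_count_eq.
apply/seteqP; split=> w /=; last by move=> [k _ /npointsP[]].
by move=> fin; exists (num_points A w) => //; apply/npointsP.
Qed.

Lemma measurable_num_points A : measurable A ->
  measurable_fun [set: Omega] (fun w => (num_points A w)%:R : R).
Proof.
(* The default values agree on infinite sets: [fine] of +oo is 0, and [points] is empty. *)
move=> mA; rewrite (_ : (fun w => _) = fine \o (fun w => npoints (S w) A)).
  apply: (@measurableT_comp _ _ _ _ _ _ (@fine R)); last exact: measurable_npoints.
  exact: fine_measurable.
apply/funext => w /=; rewrite /npoints /counting /num_points /points; case: asboolP => //.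
by move=> nfin; rewrite /fset_set; case: pselect.
Qed.

Lemma count_joint n (A : nat -> set (Pt R)) (k : nat -> nat) :
  (forall i, measurable (A i)) ->
  (forall i, (i < n)%N -> (mu (A i) < +oo)%E) ->
  (forall i j, i != j -> A i `&` A j = set0) ->
  P [set w | forall i, (i < n)%N -> npoints (S w) (A i) = ((k i)%:R)%:E] =
  (\prod_(i < n) Defs.poisson_prob (fine (mu (A i))) (k i))%:E.
Proof.
move=> mA finA dA; case: poissonS => _ _ pois joint.
rewrite -[LHS]fineK ?fin_num_measure//; last first.
  rewrite (_ : [set w | _] = \bigcap_(i in `I_n) [set w | npoints (S w) (A i) = ((k i)%:R)%:E])//.
  by apply: bigcap_measurableType => i _; exact: measurable_count_eq.
rewrite (_ : [set w | _] = [set w | forall i : 'I_n, npoints (S w) (A i) = ((k i)%:R)%:E]).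
  rewrite (joint n (fun i => A i) (fun i => k i))//; last by move=> i j; exact: dA.
  by congr _%:E; apply: eq_bigr => i _; rewrite pois// finA.
apply/seteqP; split=> w /= H; first by move=> i; exact: H.
by move=> i ni; exact: (H (Ordinal ni)).
Qed.

Lemma poisson_prob_ge0 (r : R) k : 0 <= r -> 0 <= Defs.poisson_prob r k.
Proof.
by move=> r0; rewrite mulr_ge0 ?expR_ge0// divr_ge0// exprn_ge0.
Qed.

(** The generating function E c^N = exp((c - 1) r) of the Poisson law. The constant [K] will hold
    the factors that belong to the other sets. *)
Lemma poisson_generating_series (c r K : R) : 0 <= c -> 0 <= r -> 0 <= K ->
  (\sum_(0 <= v <oo) (c ^+ v * Defs.poisson_prob r v * K)%:E =
   (expR ((c - 1) * r) * K)%:E)%E.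
Proof.
move=> c0 r0 K0.
under eq_eseriesr => v _.
  rewrite (_ : _ * _ = expR (- r) * K * ((c * r) ^+ v / v`!%:R)); last first.
    by rewrite /Defs.poisson_prob exprMn; ring.
  rewrite EFinM; over.
rewrite nneseriesZl/=; last first.
  by move=> v _; rewrite lee_fin divr_ge0// exprn_ge0// mulr_ge0.
have -> : (\sum_(0 <= v <oo) ((c * r) ^+ v / v`!%:R)%:E = (expR (c * r))%:E)%E.
  rewrite expRE -EFin_lim; last first.
    rewrite /pseries/=; under eq_fun do rewrite mulrC.
    exact: is_cvg_series_exp_coeff.
  apply/congr_lim/funext => n/=; rewrite /pseries/= /series/= -sumEFin//.
  by under eq_bigr do rewrite mulrC.
by rewrite -EFinM mulrBl mul1r expRD; congr _%:E; ring.
Qed.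

Section Generating.
Variables (n : nat) (A : nat -> set (Pt R)) (c : nat -> R).
Hypothesis mA : forall i, measurable (A i).
Hypothesis finA : forall i, (i < n)%N -> (mu (A i) < +oo)%E.
Hypothesis dA : forall i j, i != j -> A i `&` A j = set0.
Hypothesis c_gt0 : forall i, 0 < c i.

Let lam i := fine (mu (A i)).
Let lam_ge0 i : 0 <= lam i. Proof. by rewrite fine_ge0. Qed.

Let finite_counts := [set w | forall i, (i < n)%N -> finite_set (S w `&` A i)].
Let slice m (k : nat -> nat) := finite_counts `&`
  [set w | forall i, (m <= i < n)%N -> num_points (A i) w = k i].

Lemma measurable_finite_counts : measurable finite_counts.
Proof.
rewrite (_ : finite_counts = \bigcap_(i in `I_n) [set w | finite_set (S w `&` A i)])//.
by apply: bigcap_measurableType => i _; exact: measurable_finite.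
Qed.

Let measurable_slice m k : measurable (slice m k).
Proof.
rewrite (_ : slice m k = finite_counts `&`
    \bigcap_(i in [set i | (m <= i < n)%N]) [set w | npoints (S w) (A i) = ((k i)%:R)%:E]).
  apply: measurableI; first exact: measurable_finite_counts.
  by apply: bigcap_measurableType => i _; exact: measurable_count_eq.
apply/seteqP; split=> w [fw H]; split=> // i /=.
  by move=> /[dup] mi /andP[_ ni]; apply/npointsP; split; [exact: fw|exact: H].
by move=> /H /npointsP[].
Qed.

Definition gen_prod m w : R := \prod_(i < m) c i ^+ num_points (A i) w.

Lemma measurable_gen_prod m D : measurable_fun D (fun w => (gen_prod m w)%:E).
Proof.
apply: measurable_funTS; apply/measurable_EFinP.
(* Since c > 0, the powers are exponentials of the count times log c, and measurability follows from
   that of the counts. *)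
rewrite (_ : gen_prod m = fun w =>
    \prod_(i <- index_enum 'I_m) expR ((num_points (A i) w)%:R * ln (c i))).
  apply: measurable_prod => i _; apply: measurableT_comp => //.
  by apply: measurable_funM => //; exact: measurable_num_points.
by apply/funext => w; apply: eq_bigr => i _; rewrite expRM_natl lnK ?posrE.
Qed.

Lemma gen_prod_ge0 m w : 0 <= gen_prod m w.
Proof. by apply: prodr_ge0 => i _; rewrite exprn_ge0// ltW. Qed.

(* In [slice m k] the counts of the sets [A i] with [m <= i < n] are frozen at
   [k i]; [slice m.+1 k] is the disjoint union over [v] of the slices that also
   freeze the count of [A m] at [v], which is where independence enters. *)
Let integral_slice m k : (m <= n)%N ->
  (\int[P]_(w in slice m k) (gen_prod m w)%:E =
   (\prod_(i < m) expR ((c i - 1) * lam i) *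
    \prod_(m <= i < n) Defs.poisson_prob (lam i) (k i))%:E)%E.
Proof.
elim: m k => [|m ih] k mn.
  rewrite (eq_integral (cst 1%E)); last by move=> w _; rewrite /gen_prod big_ord0.
  rewrite integral_cst// mul1e big_ord0 mul1r big_mkord -count_joint//.
  congr (P _); apply/seteqP; split=> w /=.
    by move=> [fw H] i ni; apply/npointsP; split; [exact: fw|exact: H].
  by move=> H; split=> i ni; have /npointsP[] := H i ni.
pose upd v i := if i == m then v else k i.
have sliceE : slice m.+1 k = \bigcup_v slice m (upd v).
  apply/seteqP; split=> w.
    move=> [fw H]; exists (num_points (A m) w) => //; split=> // i /andP[mi ni].
    rewrite /upd; case: eqVneq => [->//|im]; apply: H.
    by rewrite ltn_neqAle eq_sym im mi.
  move=> [v _ [fw H]]; split=> // i /andP[mi ni].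
  by rewrite (H i) ?(ltnW mi)//= /upd gtn_eqF.
rewrite sliceE ge0_integral_bigcup//=; first last.
- move=> u v _ _ [w [[_ Hu] [_ Hv]]].
  have := Hu m; have := Hv m; rewrite leqnn mn => /(_ isT) + /(_ isT).
  by rewrite /upd eqxx => -> .
- by move=> w _; rewrite lee_fin gen_prod_ge0.
- exact: measurable_gen_prod.
pose K := \prod_(i < m) expR ((c i - 1) * lam i) *
    \prod_(m.+1 <= i < n) Defs.poisson_prob (lam i) (k i).
have K0 : 0 <= K.
  by apply: mulr_ge0; apply: prodr_ge0 => i _; rewrite ?expR_ge0 ?poisson_prob_ge0.
transitivity (\sum_(0 <= v <oo) (c m ^+ v * Defs.poisson_prob (lam m) v * K)%:E)%E.
  apply: eq_eseriesr => v _.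
  rewrite (eq_integral (fun w => (c m ^+ v)%:E * (gen_prod m w)%:E)%E); last first.
    move=> w /set_mem[_ Hw]; rewrite /gen_prod big_ord_recr/= EFinM muleC.
    by rewrite (Hw m) ?leqnn// /upd eqxx.
  rewrite ge0_integralZl//; first last.
  - by rewrite lee_fin exprn_ge0// ltW.
  - by move=> w _; rewrite lee_fin gen_prod_ge0.
  - exact: measurable_gen_prod.
  rewrite ih ?(ltnW mn)// -EFinM /K big_ltn// /upd eqxx.
  rewrite [X in _ * (_ * (_ * X))](_ : _ = \prod_(m.+1 <= i < n) Defs.poisson_prob (lam i) (k i)).
    by congr _%:E; ring.
  by rewrite !big_nat; apply: eq_bigr => i /andP[mi _]; rewrite gtn_eqF.
rewrite poisson_generating_series// ?(ltW (c_gt0 _))// /K big_ord_recr/=.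
by congr _%:E; ring.
Qed.

Lemma integral_gen_prod :
  (\int[P]_(w in finite_counts) (gen_prod n w)%:E =
   (\prod_(i < n) expR ((c i - 1) * lam i))%:E)%E.
Proof.
have <- : slice n (fun=> 0%N) = finite_counts.
  apply/seteqP; split=> w; first by case.
  by move=> fw; split=> // i /andP[/leq_ltn_trans H /H]; rewrite ltnn.
by rewrite integral_slice// big_geq// mulr1.
Qed.

End Generating.

(** The Poisson weights sum to 1, by the generating function at c = 1, so the finite values of the
    count exhaust the mass. *)
Lemma finite_count_ae A : measurable A -> (mu A < +oo)%E ->
  P [set w | finite_set (S w `&` A)] = 1%E.
Proof.
move=> mA finA; case: poissonS => _ _ pois _.
rewrite (_ : [set w | _] = \bigcup_k [set w | npoints (S w) A = (k%:R)%:E]); last first.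
  apply/seteqP; split=> w /=; last by move=> [k _ /npointsP[]].
  by move=> fin; exists (num_points A w) => //; apply/npointsP.
rewrite measure_bigcup//; last 2 first.
- by move=> k _; exact: measurable_count_eq.
- by move=> i j _ _ [w [/= /npointsP[_ <-] /npointsP[_ <-]]].
transitivity (\sum_(0 <= v <oo) (1 ^+ v * Defs.poisson_prob (fine (mu A)) v * 1)%:E)%E.
  transitivity (\sum_(0 <= v <oo) P [set w | npoints (S w) A = (v%:R)%:E])%E.
    by apply: eq_eseriesl => k; rewrite in_setT.
  by apply: eq_eseriesr => k _; rewrite pois// expr1n mul1r mulr1.
by rewrite poisson_generating_series ?fine_ge0// subrr mul0r expR0 mulr1.
Qed.

End PoissonCounts.

(** * Rounding a function of the mark to finitely many levels *)

Section Discretization.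
Context {R : realType} {d : measure_display} {T : measurableType d}.
Variables (nu : probability T R) (g : T -> R) (eps : R) (n : nat).
Hypothesis mg : measurable_fun [set: T] g.
Hypothesis g_ge0 : forall f, 0 <= g f.
Hypothesis eps_gt0 : 0 < eps.

(** Cells of width [eps] below index [n]; the index [n] is an overflow cell for all marks with g >=
    eps n, which keeps the partition finite. *)
Definition level f : nat := minn (Num.trunc (g f / eps)) n.

Lemma level_le f : (level f <= n)%N. Proof. exact: geq_minr. Qed.

Lemma level_lb f : eps * (level f)%:R <= g f.
Proof.
have /andP[H _] := truncn_itv (divr_ge0 (g_ge0 f) (ltW eps_gt0)).
rewrite mulrC -ler_pdivlMr//; apply: le_trans H.
by rewrite ler_nat geq_minl.
Qed.

Lemma level_ub f : level f <> n -> g f <= eps * (level f).+1%:R.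
Proof.
rewrite /level; have /andP[_ H] := truncn_itv (divr_ge0 (g_ge0 f) (ltW eps_gt0)).
move=> Hn; rewrite mulrC -ler_pdivrMr//; rewrite (minn_idPl _); first exact: ltW.
by rewrite leqNgt; apply/negP => /ltnW/minn_idPr.
Qed.

Lemma measurable_level i : measurable [set f | level f = i].
Proof.
rewrite (_ : [set f | _] = \bigcup_(k in [set k | minn k n = i])
    (g @^-1` `[eps * k%:R, eps * k.+1%:R[)).
  by apply: bigcup_measurable => k _; rewrite -[X in measurable X]setTI; exact: mg.
have trE f k : Num.trunc (g f / eps) = k <-> (g @^-1` `[eps * k%:R, eps * k.+1%:R[%classic) f.
  rewrite /= in_itv/= -(mulrC k%:R) -(mulrC k.+1%:R) -ler_pdivlMr// -ltr_pdivrMr//.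
  rewrite -truncn_eq ?divr_ge0 ?(ltW eps_gt0)//.
  by split=> [->//|/eqP].
apply/seteqP; split=> f /=.
  by move=> fi; exists (Num.trunc (g f / eps)) => //; exact/trE.
by move=> [k ki /trE tk]; rewrite /level tk.
Qed.

Lemma ge0_integral_level (h : T -> \bar R) : measurable_fun [set: T] h ->
  (forall f, 0 <= h f)%E ->
  (\int[nu]_f h f = \sum_(i <- iota 0 n.+1) \int[nu]_(f in [set f | level f = i]) h f)%E.
Proof.
move=> mh h0; rewrite -ge0_integral_bigsetU//.
- congr integral; apply/esym/seteqP; split=> // f _.
  rewrite -bigcup_seq; exists (level f) => //.
  by apply: (_ : level f \in iota 0 n.+1); rewrite mem_iota add0n ltnS level_le.
- exact: measurable_level.
- exact: iota_uniq.
- by move=> i j _ _ [f [/= <- <-]].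
- exact: measurable_funTS.
Qed.

Lemma sum_level : \sum_(0 <= i < n.+1) fine (nu [set f | level f = i]) = 1.
Proof.
apply: EFin_inj; rewrite -sumEFin -(probability_setT nu).
rewrite -[RHS]mul1e -integral_cst// ge0_integral_level//.
rewrite /index_iota subn0; apply: eq_bigr => i _.
by rewrite integral_cst ?mul1e ?fineK ?fin_num_measure//; exact: measurable_level.
Qed.

Lemma sum_level_mean (G : R) : (\int[nu]_f (g f)%:E = G%:E)%E ->
  \sum_(0 <= i < n.+1) eps * i%:R * fine (nu [set f | level f = i]) <= G.
Proof.
move=> gG; rewrite -lee_fin -gG -sumEFin ge0_integral_level//; last first.
  exact/measurable_EFinP.
rewrite /index_iota subn0; apply: lee_sum => i _.
rewrite EFinM fineK ?fin_num_measure//; last exact: measurable_level.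
rewrite -integral_cst; last exact: measurable_level.
apply: ge0_le_integral => //.
- exact: measurable_level.
- by move=> f _; rewrite lee_fin mulr_ge0// ltW.
- by apply: measurable_funTS; exact/measurable_EFinP.
- by move=> f <-; rewrite lee_fin level_lb.
Qed.

End Discretization.

(** * Tail bound for a product over the points of a region *)

Section ProductBound.
Context {R : realType} {d : measure_display} {Omega : measurableType d}.
Variables (P : probability Omega R) (S : Omega -> set (Pt R)).
Variable mu : set (Pt R) -> \bar R.
Hypothesis poissonS : is_poisson_process P S mu.
Hypothesis mu_ge0 : forall A, (0 <= mu A)%E.
Variable nu : probability (LipG R) R.
Implicit Types (w : Omega) (C : set (LipG R)).

Definition marked (W : set (Pt R)) C : set (Pt R) := W `&` [set p | C p.2].

Variables (W : set (Pt R)) (lam : R).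
Hypothesis lam_ge0 : 0 <= lam.
Hypothesis mW : measurable W.
Hypothesis muW : forall C, measurable C -> mu (marked W C) = (lam%:E * nu C)%E.

Lemma prod_level (I : Type) (c : nat -> R) (l : I -> nat) (n : nat) (s : seq I) :
  all (fun p => (l p < n)%N) s ->
  \prod_(p <- s) c (l p) = \prod_(i < n) c i ^+ count (fun p => l p == i) s.
Proof.
elim: s => [_|p s ih /= /andP[pn sn]]; first by rewrite big_nil big1.
rewrite big_cons ih// (bigD1 (Ordinal pn))//= [RHS](bigD1 (Ordinal pn))//=.
rewrite eqxx exprD expr1 -!mulrA; congr (_ * (_ * _)).
apply: eq_bigr => i /eqP ip; case: eqP => // pi.
by exfalso; apply: ip; apply: val_inj.
Qed.

Lemma measurable_marked C : measurable C -> measurable (marked W C).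
Proof.
move=> mC; apply: measurableI => //.
rewrite -[X in measurable X]setTI.
exact: (measurable_snd measurableT C mC).
Qed.

Lemma prod_points_le (g : LipG R -> R) (eps : R) (n : nat) w :
  (forall f, 0 <= g f) -> 0 < eps ->
  finite_set (S w `&` W) ->
  npoints (S w) (marked W [set f | level g eps n f = n]) = 0%:E ->
  \prod_(p <- points (S w `&` W)) g p.2 <=
  gen_prod S (fun i => marked W [set f | level g eps n f = i])
    (fun i => eps * i.+1%:R) n w.
Proof.
move=> g0 eps0 fin; rewrite -[X in X%:E]/(0%:R) => /npointsP[fin0 count0].
pose l (p : Pt R) := level g eps n p.2.
have ln p : p \in points (S w `&` W) -> (l p < n)%N.
  rewrite (in_fset_set fin) => /set_mem[Sp Wp].
  rewrite ltn_neqAle level_le andbT; apply/eqP => lpn.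
  have : p \in points (S w `&` marked W [set f | level g eps n f = n]).
    by rewrite (in_fset_set fin0); apply/mem_set.
  by rewrite (size0nil count0).
apply: (@le_trans _ _ (\prod_(p <- points (S w `&` W)) (eps * (l p).+1%:R))).
  rewrite big_seq [leRHS]big_seq; apply: ler_prod => p /ln lp.
  by rewrite g0 level_ub//; apply/eqP; rewrite ltn_eqF.
rewrite (prod_level _ (fun i => eps * i.+1%:R) l n); last exact/allP.
rewrite /gen_prod le_eqVlt; apply/orP; left; apply/eqP; apply: eq_bigr => i _.
congr (_ ^+ _); rewrite -size_filter; apply: perm_size; apply: uniq_perm.
- exact/filter_uniq/finmap.fset_uniq.
- exact: finmap.fset_uniq.
have fini : finite_set (S w `&` marked W [set f | level g eps n f = i]).
  by apply: sub_finite_set fin => p [Sp [Wp _]].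
move=> p; rewrite mem_filter (in_fset_set fin) (in_fset_set fini); apply/idP/idP.
  by move=> /andP[/eqP lpi /set_mem[Sp Wp]]; apply/mem_set.
by move=> /set_mem[Sp [Wp lpi]]; apply/andP; split; [exact/eqP|exact/mem_set].
Qed.

(** Let v_i be the mass of cell i. Rounding up adds at most eps to the mean of g; leaving out the
    overflow cell replaces -1 by -(1 - v_n), and v_n <= G / (eps n) by Markov's inequality. *)
Lemma level_gen_le (g : LipG R -> R) (eps : R) (n : nat) (G : R) :
  measurable_fun [set: LipG R] g -> (forall f, 0 <= g f) -> 0 < eps ->
  (\int[nu]_f (g f)%:E = G%:E)%E -> (0 < n)%N ->
  \prod_(i < n) expR ((eps * i.+1%:R - 1) *
    fine (mu (marked W [set f | level g eps n f = i]))) <=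
  expR (lam * (G - 1 + eps + G / (eps * n%:R))) /\
  fine (mu (marked W [set f | level g eps n f = n])) <= lam * (G / (eps * n%:R)).
Proof.
move=> mg g0 eps0 gG n0.
have mL i : measurable [set f | level g eps n f = i] by exact: measurable_level.
pose v i := fine (nu [set f | level g eps n f = i]).
have v0 i : 0 <= v i by rewrite fine_ge0.
have muE i : fine (mu (marked W [set f | level g eps n f = i])) = lam * v i.
  by rewrite muW// fineM// fin_num_measure.
have sum1 : \sum_(i < n) v i + v n = 1.
  by rewrite -(sum_level nu g eps n mg g0 eps0) big_mkord big_ord_recr.
have := sum_level_mean nu g eps n mg g0 eps0 G gG.
rewrite big_mkord big_ord_recr/= -/(v n) => sumG.
have en0 : 0 < eps * n%:R by rewrite mulr_gt0// ltr0n.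
have sum0 : 0 <= \sum_(i < n) eps * i%:R * v i.
  by apply: sumr_ge0 => i _; rewrite !mulr_ge0// ltW.
have vn : v n <= G / (eps * n%:R).
  by rewrite ler_pdivlMr// mulrC (le_trans _ sumG)// lerDr.
split; last by rewrite muE ler_wpM2l.
rewrite -expR_sum ler_expR.
rewrite (eq_bigr (fun i : 'I_n => lam * ((eps * i%:R * v i) + (eps - 1) * v i))); last first.
  by move=> i _; rewrite muE -natr1; ring.
rewrite -mulr_sumr ler_wpM2l// big_split/= -mulr_sumr.
have -> : \sum_(i < n) v i = 1 - v n by rewrite -sum1 addrK.
have : 0 <= eps * v n by rewrite mulr_ge0// ltW.
have : 0 <= eps * n%:R * v n by rewrite mulr_ge0// ltW.
move: sumG vn; set A := \sum_(i < n) _; set B := eps * n%:R * _.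
by move: (v n) (_ / _) => x y; nra.
Qed.

(* [g] is rounded up to a multiple of [eps] below the level [eps * n]; the cell
   of marks above that level contains no point outside an event of probability
   [delta]. *)
Lemma prod_points_markov (g : LipG R -> R) (G u delta : R) :
  measurable_fun [set: LipG R] g -> (forall f, 0 <= g f) ->
  (\int[nu]_f (g f)%:E = G%:E)%E -> 0 < u -> 0 < delta ->
  exists E, [/\ measurable E,
    (P E <= (expR (lam * (G - 1) + delta) / u + delta)%:E)%E &
    forall w, ~ E w -> finite_set (S w `&` W) /\
       \prod_(p <- points (S w `&` W)) g p.2 <= u].
Proof.
move=> mg g0 gG u0 delta0.
have G0 : 0 <= G by rewrite -lee_fin -gG integral_ge0// => f _; rewrite lee_fin.
(* The error in the exponent is lam (eps + G / (eps n)) <= 2 lam eps <= delta, once [n] makes G /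
   (eps n) <= eps. Dividing by lam + 1 covers lam = 0. *)
have [eps eps0 lameps] : exists2 eps : R, 0 < eps & lam * eps <= delta / 2.
  have lam1 : 0 < lam + 1 by rewrite ltr_wpDl.
  exists (delta / (2 * (lam + 1))); first by rewrite divr_gt0// mulr_gt0.
  have -> : lam * (delta / (2 * (lam + 1))) = delta / 2 * (lam / (lam + 1)).
    by field; rewrite gt_eqF.
  rewrite ler_piMr ?divr_ge0 ?(ltW delta0)// ler_pdivrMr// mul1r.
  by rewrite lerDl.
have [n n0 Gn] : exists2 n, (0 < n)%N & G / (eps * n%:R) <= eps.
  have ee0 : 0 < eps * eps by rewrite mulr_gt0.
  exists (Num.trunc (G / (eps * eps))).+1 => //.
  have /andP[_ /ltW] := truncn_itv (divr_ge0 G0 (ltW ee0)).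
  rewrite ler_pdivrMr// => GN.
  rewrite ler_pdivrMr ?mulr_gt0 ?ltr0n// (le_trans GN)//.
  by rewrite le_eqVlt; apply/orP; left; apply/eqP; ring.
have [gen tail] := level_gen_le g eps n G mg g0 eps0 gG n0.
pose A i := marked W [set f | level g eps n f = i].
have mL i : measurable [set f | level g eps n f = i] by exact: measurable_level.
have mA i : measurable (A i) by exact: measurable_marked.
have finA i : (mu (A i) < +oo)%E.
  by rewrite muW// lte_mul_pinfty// ?lee_fin// (le_lt_trans (probability_le1 _ _))// ltry.
have dA i j : i != j -> A i `&` A j = set0.
  move=> ij; apply/seteqP; split=> // p [[_ /= pi] [_ /= pj]].
  by move: ij; rewrite -pi -pj eqxx.
have c0 i : 0 < eps * i.+1%:R by rewrite mulr_gt0.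
pose fc := [set w | forall i, (i < n)%N -> finite_set (S w `&` A i)].
have mfc : measurable fc by exact: (measurable_finite_counts P _ _ poissonS).
pose X w := gen_prod S A (fun i => eps * i.+1%:R) n w.
have intX : (\int[P]_(w in fc) (X w)%:E <= (expR (lam * (G - 1) + delta))%:E)%E.
  rewrite (integral_gen_prod P S mu poissonS mu_ge0 n A _ mA (fun i _ => finA i) dA c0).
  rewrite lee_fin (le_trans gen)// ler_expR.
  have : lam * (G / (eps * n%:R)) <= lam * eps by rewrite ler_wpM2l.
  by nra.
(* [E1] is null; [E2] has probability 1 - exp(-mu) <= mu for the intensity mu of the overflow cell;
   [E3] is bounded by Markov's inequality for the rounded product. *)
pose E1 := ~` [set w | finite_set (S w `&` W)].
pose E2 := ~` [set w | npoints (S w) (A n) = (0%:R)%:E].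
pose E3 := fc `&` [set w | u <= X w].
have mX : measurable_fun [set: Omega] (fun w => (X w)%:E).
  exact: (measurable_gen_prod P S mu poissonS).
have mE1 : measurable E1 by apply: measurableC; exact: (measurable_finite P S mu poissonS).
have mE2 : measurable E2 by apply: measurableC; exact: (measurable_count_eq P S mu poissonS).
have mE3 : measurable E3.
  apply: measurableI => //; rewrite -[X in measurable X]setTI.
  rewrite (_ : [set w | _] = (fun w => (X w)%:E) @^-1` `[u%:E, +oo[%classic).
    by apply: mX => //; exact: emeasurable_itv.
  by apply/seteqP; split=> w /=; rewrite in_itv/= andbT lee_fin.
have PE1 : P E1 = 0%E.
  have finW : (mu W < +oo)%E.
    have -> : W = marked W setT by rewrite /marked setIT.
    by rewrite muW// probability_setT mule1 ltry.
  rewrite probability_setC; last exact: (measurable_finite P S mu poissonS).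
  by rewrite (finite_count_ae P S mu poissonS mu_ge0 _ mW finW) subee.
have PE2 : (P E2 <= delta%:E)%E.
  rewrite probability_setC; last exact: (measurable_count_eq P S mu poissonS).
  have [_ _ -> // _] := poissonS; rewrite -EFinD lee_fin.
  rewrite /Defs.poisson_prob expr0 mul1r fact0 invr1 mul1r.
  have := expR_ge1Dx (- fine (mu (A n))).
  have : lam * (G / (eps * n%:R)) <= lam * eps by rewrite ler_wpM2l.
  by move: tail; rewrite -/(A n); lra.
have PE3 : (P E3 <= (expR (lam * (G - 1) + delta) / u)%:E)%E.
  rewrite mulrC EFinM lee_pdivlMl//; apply: le_trans intX.
  apply: (@le_trans _ _ (\int[P]_(w in E3) (X w)%:E)%E).
    rewrite -integral_cst//; apply: ge0_le_integral => //.
    - by move=> w _; rewrite lee_fin ltW.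
    - exact: measurable_funTS.
    - by move=> w [_ /= uX]; rewrite lee_fin.
  have E3fc : E3 `<=` fc by move=> w [].
  apply: (ge0_subset_integral P mE3 mfc _ _ E3fc).
  - exact: measurable_funTS.
  - by move=> w _; rewrite lee_fin gen_prod_ge0.
exists (E1 `|` E2 `|` E3); split.
- by apply: measurableU => //; exact: measurableU.
- apply: (le_trans (measureU2 _ (measurableU _ _ mE1 mE2) mE3)).
  rewrite addeC EFinD leeD//; apply: (le_trans (measureU2 _ mE1 mE2)).
  by rewrite [X in (X + _)%E]PE1 add0e.
move=> w /not_orP[/not_orP[/contrapT fin /contrapT np] nE3]; split=> //.
rewrite (le_trans (prod_points_le g eps n w g0 eps0 fin np))//.
rewrite leNgt; apply/negP => uX; apply: nE3; split; last exact: ltW.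
by move=> i _; apply: sub_finite_set fin => p [Sp [Wp _]].
Qed.

End ProductBound.

(** * Intensity of rectangles *)

Section Strips.
Context {R : realType}.
Variable nu : probability (LipG R) R.

Lemma intensity_ge0 A : (0 <= intensity nu A)%E.
Proof. exact: measure_ge0. Qed.

Lemma stripE (I J : interval R) :
  strip I J = ([set` I] `*` [set` J]) `*` [set: LipG R].
Proof. by apply/seteqP; split=> p /=; [case|case=> -[]]. Qed.

Lemma measurable_strip (I J : interval R) : measurable (strip I J).
Proof.
rewrite stripE; apply: measurableX => //.
by apply: measurableX; exact: measurable_itv.
Qed.

Lemma intensity_strip (I J : interval R) (l1 l2 : R) (C : set (LipG R)) :
  measurable C ->
  [set` I] `<=` [set` `[0, +oo[ ] -> [set` J] `<=` [set` `[0, +oo[ ] ->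
  lebesgue_measure [set` I] = l1%:E -> lebesgue_measure [set` J] = l2%:E ->
  intensity nu (marked (strip I J) C) = ((l1 * l2)%:E * nu C)%E.
Proof.
move=> mC I0 J0 Il Jl.
have mI : measurable [set` I] by exact: measurable_itv.
have mJ : measurable [set` J] by exact: measurable_itv.
rewrite /intensity (_ : _ `&` _ = ([set` I] `*` [set` J]) `*` C).
  rewrite product_measure1E//; last exact: measurableX.
  by congr (_ * _)%E; rewrite EFinM -Il -Jl; exact: product_measure1E.
rewrite /marked stripE; apply/seteqP; split=> p /=.
  by move=> [[[[? ?] _] ?] _].
move=> [[pI pJ] pC]; split; first by split.
have := I0 _ pI; have := J0 _ pJ; rewrite /= !in_itv/= !andbT.
by rewrite /quadrant /=.
Qed.

End Strips.

(** * Almost surely no two points share a time *)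

Section Ties.
Context {R : realType} {d : measure_display} {Omega : measurableType d}.
Variables (P : probability Omega R) (S : Omega -> set (Pt R)).
Variable nu : probability (LipG R) R.
Hypothesis poissonS : is_poisson_process P S (intensity nu).

Lemma strip_marked_setT (I J : interval R) : strip I J = marked (strip I J) setT.
Proof. by rewrite /marked; apply/seteqP; split=> p // []. Qed.

(** From exp(-lam) >= 1 - lam follows 1 - (1 + lam) exp(-lam) <= 1 - (1 + lam) (1 - lam) = lam^2. *)
Lemma poisson_ge2_le (W : set (Pt R)) (lam : R) : measurable W -> 0 <= lam ->
  intensity nu W = lam%:E ->
  (P (~` ([set w | npoints (S w) W = (0%:R)%:E] `|`
          [set w | npoints (S w) W = (1%:R)%:E])) <= (lam ^+ 2)%:E)%E.
Proof.
move=> mW lam0 muW; have [_ _ pois _] := poissonS.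
have m0 := measurable_count_eq P S _ poissonS W 0 mW.
have m1 := measurable_count_eq P S _ poissonS W 1 mW.
set E0 := [set w | _] in m0 *; set E1 := [set w | _] in m1 *.
have E01 : E0 `&` E1 = set0.
  by apply/seteqP; split=> // w []; rewrite /E0 /E1 /= => -> /eqP; rewrite eqe eqr_nat.
rewrite probability_setC; last exact: measurableU.
have finW : (intensity nu W < +oo)%E by rewrite muW ltry.
have -> : P (E0 `|` E1) = (Defs.poisson_prob lam 0 + Defs.poisson_prob lam 1)%:E.
  rewrite EFinD -[lam]/(fine lam%:E) -muW.
  by rewrite -(pois W 0 mW finW) -(pois W 1 mW finW); exact: measureU.
rewrite -EFinD lee_fin.
rewrite /Defs.poisson_prob expr0 expr1 !fact0 !invr1 !mulr1 mul1r.
have := expR_ge1Dx (- lam); move: (expR _) => e e1.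
have : 0 <= (1 + lam) * (e - (1 - lam)) by rewrite mulr_ge0//; lra.
by nra.
Qed.

Definition has_tie (n : nat) : set Omega := [set w | exists p q,
  [/\ (S w `&` window n%:R n%:R) p, (S w `&` window n%:R n%:R) q,
      p.1.1 = q.1.1 & p <> q]].

(* Two points with the same time lie in a common cell among [m + 1] cells of
   intensity [n^2 / (m + 1)], and a cell of intensity [lam] contains two points
   with probability at most [lam^2]. *)
Lemma has_tie_negligible n : P.-negligible (has_tie n).
Proof.
(* The time intervals are closed so that the last one contains the time [n]; their overlaps are
   harmless in a union bound. *)
pose cell (m i : nat) : set (Pt R) :=
  strip `[n%:R * i%:R / m.+1%:R, n%:R * i.+1%:R / m.+1%:R] `[0, n%:R].
pose crowded m i := ~` ([set w | npoints (S w) (cell m i) = (0%:R)%:E] `|`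
          [set w | npoints (S w) (cell m i) = (1%:R)%:E]).
pose bad m := \big[setU/set0]_(i < m.+1) crowded m i.
have mcrowded m i : measurable (crowded m i).
  apply: measurableC; apply: measurableU;
  exact: (measurable_count_eq P S _ poissonS _ _ (measurable_strip _ _)).
have mbad m : measurable (bad m) by exact: bigsetU_measurable.
have m0 (m : nat) : 0 < (m.+1%:R : R) by rewrite ltr0n.
(* The sum is (m + 1) (n^2 / (m + 1))^2. It tends to 0 in m, while a tie belongs to every
   [bad m]. *)
have Pbad m : (P (bad m) <= (n%:R ^+ 4 / m.+1%:R)%:E)%E.
  rewrite (_ : _ / _ = \sum_(i < m.+1) (n%:R * n%:R / m.+1%:R) ^+ 2); last first.
    rewrite sumr_const card_ord -mulr_natr.
    by field; rewrite gt_eqF.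
  rewrite -sumEFin; apply: (le_trans (Boole_inequality P (fun i _ => mcrowded m i))).
  apply: lee_sum => i _; apply: poisson_ge2_le.
  - exact: measurable_strip.
  - by rewrite divr_ge0// mulr_ge0.
  - rewrite /cell strip_marked_setT.
    have -> : n%:R * n%:R / m.+1%:R = n%:R / m.+1%:R * n%:R :> R by ring.
    rewrite (intensity_strip _ _ _ (n%:R / m.+1%:R) n%:R) ?probability_setT ?mule1//.
    + move=> x /=; rewrite !in_itv/= andbT => /andP[ix _].
      by rewrite (le_trans _ ix)// divr_ge0// mulr_ge0.
    + by move=> x /=; rewrite !in_itv/= andbT => /andP[].
    + rewrite lebesgue_measure_itv/= lte_fin; case: ltP => [_|].
        by rewrite -EFinB; congr _%:E; rewrite -natr1; field; rewrite gt_eqF.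
      rewrite ler_pM2r ?invr_gt0// -natr1 mulrDr mulr1 gerDl => n0.
      have -> : n%:R = 0 :> R by apply/eqP; rewrite eq_le n0/=.
      by rewrite mul0r.
    + rewrite lebesgue_measure_itv/= lte_fin; case: ltP => [_|n0].
        by rewrite -EFinB subr0.
      by congr _%:E; apply/esym/eqP; rewrite eq_le n0/=.
exists (\bigcap_m bad m); split.
- exact: bigcapT_measurable.
- apply/eqP; rewrite eq_le measure_ge0 andbT.
  apply/lee_addgt0Pr => e e0; rewrite add0e.
  pose m := Num.trunc (n%:R ^+ 4 / e : R).
  apply: (@le_trans _ _ (P (bad m))).
    apply: le_measure; rewrite ?inE//; first exact: bigcapT_measurable.
    by move=> w; exact.
  apply: (le_trans (Pbad m)); rewrite lee_fin ler_pdivrMr// mulrC -ler_pdivrMr//.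
  by have /andP[_ /ltW] := truncn_itv (divr_ge0 (exprn_ge0 4 (ler0n R n)) (ltW e0)).
move=> w [p [q [[Sp [tp xp]] [Sq [tq xq]] pq npq]]] m _.
have := tp; move=> /andP[p0 pn].
have [i im /andP[ip pi]] : exists2 i, (i < m.+1)%N &
    n%:R * i%:R / m.+1%:R <= p.1.1 <= n%:R * i.+1%:R / m.+1%:R.
  have [n0|n0] := leP (n%:R : R) 0.
    exists 0 => //; have -> : n%:R = 0 :> R by apply/eqP; rewrite eq_le n0/=.
    by rewrite !mul0r p0 (le_trans pn).
  have [pln|] := ltP p.1.1 n%:R; last first.
    move=> np; exists m => //; have -> : p.1.1 = n%:R by apply/eqP; rewrite eq_le pn.
    by rewrite mulfK ?gt_eqF// lexx andbT ler_pdivrMr// ler_wpM2l// ler_nat.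
  have y0 : 0 <= p.1.1 * m.+1%:R / n%:R by rewrite divr_ge0// mulr_ge0.
  exists (Num.trunc (p.1.1 * m.+1%:R / n%:R)).
    rewrite truncn_lt_nat//.
    by rewrite ltr_pdivrMr// mulrC ltr_pM2l.
  have /andP[l1 /ltW l2] := truncn_itv y0.
  move: l1 l2; rewrite ler_pdivlMr// ler_pdivrMr// => l1 l2.
  by rewrite ler_pdivrMr// ler_pdivlMr// mulrC l1/= [leRHS]mulrC.
rewrite /bad -bigcup_mkord; exists i => //=.
have cp : (S w `&` cell m i) p.
  by split=> //; rewrite /cell /strip/= !in_itv/= ip pi.
have cq : (S w `&` cell m i) q.
  by split=> //; rewrite /cell /strip/= !in_itv/= -pq ip pi.
have mem r : finite_set (S w `&` cell m i) -> (S w `&` cell m i) r ->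
    r \in points (S w `&` cell m i).
  by move=> fin; rewrite (in_fset_set fin) => rS; apply/mem_set.
move=> [] /npointsP[fin]; rewrite /num_points.
  by move=> c; move: (mem _ fin cp); rewrite (size0nil c).
move=> c1; have : size (points (S w `&` cell m i)) = 1%N := c1.
move: (mem _ fin cp) (mem _ fin cq).
case: (points _) => [//|x [|y l]//]; rewrite !inE => /eqP px /eqP qx _.
by apply: npq; rewrite px qx.
Qed.

End Ties.

(** * Borel-Cantelli for products over a sequence of regions *)

Section Eventually.
Context {R : realType} {d : measure_display} {Omega : measurableType d}.
Variables (P : probability Omega R) (S : Omega -> set (Pt R)).
Variable nu : probability (LipG R) R.
Hypothesis poissonS : is_poisson_process P S (intensity nu).

Lemma summable_events_negligible (E : nat -> set Omega) (K r : R) :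
  (forall m, measurable (E m)) -> 0 <= K -> 0 < r < 1 ->
  (forall m, P (E m) <= (K * r ^+ m)%:E)%E ->
  P.-negligible (~` [set w | exists N, forall m, (N <= m)%N -> ~ E m w]).
Proof.
move=> mE K0 /andP[r0 r1] PE; exists (lim_sup_set E); split.
- by apply: bigcapT_measurable => n; apply: bigcup_measurable.
- apply: lim_sup_set_cvg0 => //; apply: (@le_lt_trans _ _ (K * (1 - r)^-1)%:E); last exact: ltry.
  apply: lime_le; first by apply: is_cvg_nneseries.
  apply: nearW => n; rewrite (@le_trans _ _ (\sum_(0 <= m < n) (K * r ^+ m)%:E)%E)//.
    by apply: lee_sum => m _; exact: PE.
  rewrite sumEFin lee_fin; apply: (@geometric_le_lim R n K r) => //.
  by rewrite gtr0_norm.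
move=> w nN N _; apply: contrapT => H; apply: nN; exists N => m Nm Em.
by apply: H; exists m.
Qed.

(** Markov's inequality at the threshold c^m turns the mean K (c r)^m into K r^m; the tolerance
    [delta] of the rounding is also set to r^m, so the probabilities remain summable. *)
Lemma prod_points_eventually (W : nat -> set (Pt R)) (lam : nat -> R)
    (g : LipG R -> R) (G c r K : R) :
  (forall m, 0 <= lam m) -> (forall m, measurable (W m)) ->
  (forall m C, measurable C -> intensity nu (marked (W m) C) = ((lam m)%:E * nu C)%E) ->
  measurable_fun [set: LipG R] g -> (forall f, 0 <= g f) ->
  (\int[nu]_f (g f)%:E = G%:E)%E ->
  0 < c -> 0 < r < 1 -> 0 <= K ->
  (forall m, expR (lam m * (G - 1)) <= K * (c * r) ^+ m) ->
  P.-negligible (~` [set w | exists N, forall m, (N <= m)%N ->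
    \prod_(p <- points (S w `&` W m)) g p.2 <= c ^+ m]).
Proof.
move=> lam0 mW muW mg g0 gG c0 r01 K0 HK; have /andP[r0 r1] := r01.
have [E HE] := choice (fun m => prod_points_markov P S _ poissonS (intensity_ge0 nu) nu
  (W m) (lam m) (lam0 m) (mW m) (muW m) g G (c ^+ m) (r ^+ m) mg g0 gG
  (exprn_gt0 m c0) (exprn_gt0 m r0)).
(* The factor [expR 1] bounds exp(delta), because delta = r^m <= 1. *)
have PE m : (P (E m) <= ((expR 1 * K + 1) * r ^+ m)%:E)%E.
  have [_ PEm _] := HE m; apply: (le_trans PEm); rewrite lee_fin mulrDl mul1r lerD2r.
  rewrite ler_pdivrMr ?exprn_gt0// expRD mulrC -!mulrA ler_pM ?expR_ge0//.
    by rewrite ler_expR exprn_ile1// ltW.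
  by rewrite -exprMn [r * c]mulrC.
apply: negligibleS (summable_events_negligible E _ _ _ _ r01 PE); last 2 first.
- by move=> m; have [] := HE m.
- by rewrite addr_ge0// mulr_ge0// expR_ge0.
apply: subsetC => w [N HN]; exists N => m Nm; have [_ _ H] := HE m.
by have [] := H w (HN m Nm).
Qed.

End Eventually.

(** * Fractional moments of the Lipschitz constant *)

Section FractionalMoments.
Context {R : realType}.

Lemma root_exprn (n : nat) (x : R) : (0 < n)%N -> 0 <= x -> (x `^ n%:R^-1) ^+ n = x.
Proof.
move=> n0 x0; rewrite -powR_mulrn ?powR_ge0// -powRrM mulVf ?powRr1//.
by rewrite pnatr_eq0 -lt0n.
Qed.

Lemma root_le (n : nat) (x y : R) : (0 < n)%N -> 0 <= x -> 0 <= y ->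
  x <= y ^+ n -> x `^ n%:R^-1 <= y.
Proof.
move=> n0 x0 y0 xy; rewrite -[leRHS]powRr1//.
rewrite -[in leRHS](@divff _ (n%:R : R)) ?pnatr_eq0 -?lt0n// powRrM powR_mulrn//.
by apply: ge0_ler_powR; rewrite ?nnegrE ?exprn_ge0// invr_ge0.
Qed.

Lemma bernoulli_le (n : nat) (y : R) : 0 <= y -> n%:R * (y - 1) <= y ^+ n - 1.
Proof.
move=> y0; elim: n => [|n ih]; first by rewrite mul0r expr0 subrr.
rewrite exprS -natr1 mulrDl mul1r.
have : 0 <= n%:R * (y - 1) ^+ 2 by rewrite mulr_ge0// sqr_ge0.
have : y * (n%:R * (y - 1)) <= y * (y ^+ n - 1) by rewrite ler_wpM2l.
by rewrite expr2; nra.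
Qed.

(** With n = k + 2 and l = log x, the inequality exp(t) >= 1 + t at t = l / n and t = -l / n gives l
    <= n (exp(l / n) - 1) <= l exp(l / n). The shift by 2 yields an exponent 1/n with n >= 2. *)
Lemma cvg_root_log (x : R) : 0 < x ->
  k.+2%:R * (x `^ k.+2%:R^-1 - 1) @[k --> \oo] --> ln x.
Proof.
move=> x0; pose l := ln x.
have xE (k : nat) : x `^ k.+2%:R^-1 = expR (k.+2%:R^-1 * l) by rewrite /powR gt_eqF.
have k0 (k : nat) : 0 < k.+2%:R :> R by rewrite ltr0n.
have cvE : l * expR (k.+2%:R^-1 * l) @[k --> \oo] --> l.
  have cv0 : (k.+2%:R^-1 * l : R) @[k --> \oo] --> (0 : R).
    rewrite -[X in _ --> X](mul0r l); apply: cvgM; last exact: cvg_cst.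
    have := @cvg_harmonic R; rewrite -cvg_shiftS; exact.
  have := continuous_cvg _ (@continuous_expR R 0) cv0; rewrite expR0 => cv1.
  by rewrite -[X in _ --> X]mulr1; apply: cvgM; [exact: cvg_cst|exact: cv1].
apply: (squeeze_cvgr _ (cvg_cst l) cvE); apply: nearW => k.
rewrite xE; set e := expR _; apply/andP; split.
  rewrite mulrC -ler_pdivrMr// mulrC lerBrDr addrC; exact: expR_ge1Dx.
have le1 : 1 - k.+2%:R^-1 * l <= e^-1 by rewrite -expRN expR_ge1Dx.
have e0 : 0 < e by exact: expR_gt0.
have : 1 - e^-1 <= k.+2%:R^-1 * l by rewrite lerBlDr addrC -lerBlDr.
rewrite -(ler_pM2l e0) mulrBr mulr1 divff ?gt_eqF// => H.
by rewrite mulrC -ler_pdivlMr// (le_trans H)// le_eqVlt; apply/orP; left; apply/eqP; ring.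
Qed.

Context {d : measure_display} {T : measurableType d}.
Variables (nu : probability T R) (L : T -> R) (e : R).
Hypothesis mL : measurable_fun [set: T] L.
Hypothesis L_ge0 : forall f, 0 <= L f.
Hypothesis intL : (\int[nu]_f (L f)%:E = e%:E)%E.

Lemma measurable_root (n : nat) (g : T -> R) : measurable_fun [set: T] g ->
  measurable_fun [set: T] (fun f => g f `^ n%:R^-1).
Proof. by move=> mg; exact: (measurableT_comp (measurable_powR _) mg). Qed.

Lemma integral_root_fin (n : nat) (g h : T -> R) : (0 < n)%N ->
  measurable_fun [set: T] g -> measurable_fun [set: T] h ->
  (forall f, 0 <= g f) -> (forall f, 0 <= h f) -> (forall f, g f <= h f ^+ n) ->
  (\int[nu]_f (h f)%:E < +oo)%E ->
  exists G, (\int[nu]_f (g f `^ n%:R^-1)%:E = G%:E)%E.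
Proof.
move=> n0 mg mh g0 h0 gh inth; exists (fine (\int[nu]_f (g f `^ n%:R^-1)%:E)).
rewrite fineK// ge0_fin_numE; last by apply: integral_ge0 => f _; rewrite lee_fin powR_ge0.
apply: le_lt_trans inth; apply: ge0_le_integral => //.
- by move=> f _; rewrite lee_fin powR_ge0.
- by apply/measurable_EFinP; exact: measurable_root.
- exact/measurable_EFinP.
- by move=> f _; rewrite lee_fin root_le.
Qed.

Lemma measurable_elog : measurable_fun [set: T] (fun f => elog (L f)).
Proof.
apply: measurable_fun_ifT => //.
  exact: measurable_fun_eqr.
by apply/measurable_EFinP; exact: (measurableT_comp (@measurable_ln R) mL).
Qed.

(* The functions [n (L^(1/n) - 1)] decrease to [log L], so if all of them had a
   nonnegative mean then so would [log L]: apply Fatou to [L - 1 - n (L^(1/n) - 1)],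
   which is nonnegative by Bernoulli's inequality. *)
Lemma exists_contracting_moment : (\int[nu]_f elog (L f) < 0)%E ->
  exists n : nat, (1 < n)%N /\ (\int[nu]_f (L f `^ n%:R^-1)%:E < 1)%E.
Proof.
move=> elog0; apply: contrapT => H.
have ge1 (n : nat) : (1 < n)%N -> (1 <= \int[nu]_f (L f `^ n%:R^-1)%:E)%E.
  by move=> n1; rewrite leNgt; apply/negP => lt1; apply: H; exists n.
pose h (k : nat) f := L f - 1 - k.+2%:R * (L f `^ k.+2%:R^-1 - 1).
have mr k : measurable_fun [set: T] (fun f => L f `^ k.+2%:R^-1) by exact: measurable_root.
have mh k : measurable_fun [set: T] (EFin \o h k).
  apply/measurable_EFinP; apply: measurable_funB; first exact: measurable_funB.
  by apply: measurable_funM => //; exact: measurable_funB.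
have h0 k f : 0 <= h k f.
  by rewrite subr_ge0 -[X in _ <= X - 1](root_exprn k.+2)// bernoulli_le// powR_ge0.
(* The term n L^(1/n) is moved to the other side first, so that only integrals of nonnegative
   functions are added; [ge1] then bounds it from below. *)
have inth k : (\int[nu]_f (h k f)%:E <= (e - 1)%:E)%E.
  have : (\int[nu]_f ((h k f)%:E + (k.+2%:R * L f `^ k.+2%:R^-1)%:E) =
          \int[nu]_f ((L f)%:E + (k.+2%:R - 1)%:E))%E.
    apply: eq_integral => f _; rewrite -!EFinD /h; congr _%:E; ring.
  have k1 : 0 <= k.+2%:R - 1 :> R by rewrite subr_ge0 ler1n.
  have hk0 f : [set: T] f -> (0 <= (h k f)%:E)%E by rewrite lee_fin.
  have r0 f : [set: T] f -> (0 <= (k.+2%:R * L f `^ k.+2%:R^-1)%:E)%E.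
    by rewrite lee_fin mulr_ge0// powR_ge0.
  have mkr : measurable_fun [set: T] (fun f => (k.+2%:R * L f `^ k.+2%:R^-1)%:E).
    by apply/measurable_EFinP; exact: measurable_funM.
  have L0' f : [set: T] f -> (0 <= (L f)%:E)%E by rewrite lee_fin.
  have mL' : measurable_fun [set: T] (fun f => (L f)%:E) by exact/measurable_EFinP.
  rewrite (ge0_integralD _ measurableT hk0 (mh k) r0 mkr).
  rewrite (ge0_integralD _ measurableT L0' mL') => //.
  have -> : (\int[nu]_f (k.+2%:R * L f `^ k.+2%:R^-1)%:E =
             k.+2%:R%:E * \int[nu]_f (L f `^ k.+2%:R^-1)%:E)%E.
    rewrite -ge0_integralZl//; first by apply/measurable_EFinP; exact: mr.
    by move=> f _; rewrite lee_fin powR_ge0.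
  have -> : (\int[nu]_f (k.+2%:R - 1)%:E = (k.+2%:R - 1)%:E)%E.
    by rewrite integral_cst// -[RHS]mule1; congr (_ * _)%E; exact: probability_setT.
  rewrite intL => E.
  have : (\int[nu]_f (h k f)%:E + k.+2%:R%:E <= e%:E + (k.+2%:R - 1)%:E)%E.
    rewrite -E leeD2l// -[leLHS]mule1 lee_wpmul2l// ?lee_fin//.
    exact: ge1.
  rewrite -EFinD -leeBrDr// -EFinB.
  by rewrite (_ : e + _ - _ = e - 1)//; ring.
pose phi f := ((L f - 1)%:E - elog (L f))%E.
have cvphi f : (h k f)%:E @[k --> \oo] --> phi f.
  (* Where L = 0, the function [h k] equals k + 1 and tends to +oo, in accordance with log 0 =
     -oo. *)
  rewrite /phi /elog; case: eqP => [L0|/eqP L0].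
    rewrite /= addey//; apply/cvgeryP.
    have -> : (fun k => h k f) = (fun k : nat => k.+1%:R).
      by apply/funext => k; rewrite /h L0 powR0 ?invr_eq0 ?pnatr_eq0// -!natr1; ring.
    have := @cvgr_idn R; rewrite -cvg_shiftS; exact.
  rewrite -EFinB; apply: cvg_EFin; first exact: nearW.
  apply: cvgB; first exact: cvg_cst.
  by apply: cvg_root_log; rewrite lt_neqAle eq_sym L0 L_ge0.
have intphi : (\int[nu]_f phi f <= (e - 1)%:E)%E.
  have -> : (\int[nu]_f phi f = \int[nu]_f limn_einf (fun k => (h k f)%:E))%E.
    apply: eq_integral => f _; rewrite is_cvg_limn_einfE.
      by apply/esym/cvg_lim => //; exact: cvphi.
    by apply/cvg_ex; exists (phi f); exact: cvphi.
  apply: (le_trans (fatou nu measurableT mh _)).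
    by move=> k f _; rewrite lee_fin.
  rewrite limn_einf_lim; apply: lime_le; first exact: is_cvg_einfs.
  apply: nearW => k; apply: le_trans (inth k).
  by apply: ereal_inf_lbound; exists k => /=.
have phi0 f : (0 <= phi f)%E.
  by apply: (cvge_to_ge (cvphi f)); apply: nearW => k; rewrite lee_fin.
have mphi : measurable_fun [set: T] phi.
  apply: emeasurable_funB; last exact: measurable_elog.
  by apply/measurable_EFinP; exact: measurable_funB.
have mE := measurable_elog.
pose E f := elog (L f).
have mEp : measurable_fun [set: T] E^\+%E by exact: measurable_funepos.
have mEn : measurable_fun [set: T] E^\-%E by exact: measurable_funeneg.
have Ep_le : (\int[nu]_f (E^\+%E f) <= e%:E)%E.
  rewrite -intL; apply: ge0_le_integral => //.
  - exact/measurable_EFinP.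
  - move=> f _; rewrite funeposE /E /elog; case: eqP => [_|/eqP L0].
      by rewrite maxNye lee_fin.
    rewrite ge_max !lee_fin L_ge0 andbT.
    have Lf0 : 0 < L f by rewrite lt_neqAle eq_sym L0 L_ge0.
    by rewrite -ler_expR lnK ?posrE// (le_trans _ (expR_ge1Dx _))// lerDr.
(* The negative part of log L may a priori have infinite mean, so phi = L - 1 - E is integrated in a
   form whose terms are all nonnegative. *)
have key : (\int[nu]_f phi f + \int[nu]_f (E^\+%E f) + 1 = e%:E + \int[nu]_f (E^\-%E f))%E.
  have phi0' f : [set: T] f -> (0 <= phi f)%E by [].
  have Ep0 f : [set: T] f -> (0 <= E^\+%E f)%E by [].
  have En0 f : [set: T] f -> (0 <= E^\-%E f)%E by [].
  have L0' f : [set: T] f -> (0 <= (L f)%:E)%E by rewrite lee_fin.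
  have mL' : measurable_fun [set: T] (fun f => (L f)%:E) by exact/measurable_EFinP.
  have -> : 1%E = (\int[nu]_f (cst 1%E f))%E.
    by rewrite integral_cst// -[LHS]mule1; congr (_ * _)%E; exact/esym/probability_setT.
  rewrite -intL -(ge0_integralD _ measurableT phi0' mphi Ep0 mEp).
  rewrite -(ge0_integralD _ measurableT L0' mL' En0 mEn).
  have phiEp0 f : [set: T] f -> (0 <= phi f + E^\+%E f)%E by move=> _; rewrite adde_ge0.
  have mphiEp : measurable_fun [set: T] (fun f => phi f + E^\+%E f)%E.
    exact: emeasurable_funD.
  rewrite -(ge0_integralD _ measurableT phiEp0 mphiEp)//.
  apply: eq_integral => f _; rewrite /phi funeposE funenegE /E /elog /=.
  case: eqP => [->|_].
    by rewrite sub0r maxNye adde0 /= maxye !addye.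
  case: (leP 0 (ln (L f))) => l0.
    rewrite (max_idPl _) ?lee_fin// (max_idPr _); last by rewrite -EFinN lee_fin oppr_le0.
    by rewrite -EFinB -!EFinD; congr _%:E; ring.
  rewrite (max_idPr _) ?lee_fin ?(ltW l0)// (max_idPl _); last by rewrite -EFinN lee_fin oppr_ge0 ltW.
  by rewrite -EFinB -!EFinD; congr _%:E; ring.
have Epfin : (\int[nu]_f E^\+ f)%E \is a fin_num.
  rewrite ge0_fin_numE; last exact: integral_ge0.
  by rewrite (le_lt_trans Ep_le)// ltry.
(* The mean of [phi] is at most e - 1, and the finite [e] cancels in [key]; this contradicts E log L
   < 0. *)
have : (\int[nu]_f (E^\-%E f) <= \int[nu]_f (E^\+%E f))%E.
  rewrite -(@leeD2lE _ e%:E)// -key -(fineK Epfin).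
  apply: (le_trans (leeD2r _ (leeD2r _ intphi))).
  by rewrite -!EFinD lee_fin; lra.
move: elog0; rewrite integralE -/E => + Enp; rewrite ltNge => /negP; apply.
by rewrite sube_ge0// Epfin orbT.
Qed.

End FractionalMoments.

(** * Bounded variation on an interval with b / a close to 1 *)

Section LocalBound.
Context {R : realType} {d : measure_display} {Omega : measurableType d}.
Variables (P : probability Omega R) (nu : probability (LipG R) R) (z0 : R).
Variable S : Omega -> set (Pt R).
Hypothesis poissonS : is_poisson_process P S (intensity nu).

Lemma windowE (t x : R) : window t x = strip `[0, t] `[0, x].
Proof. by apply/seteqP; split=> p; rewrite /window /strip /= !in_itv. Qed.

Lemma itv_len (b1 b2 : bool) (x y : R) : x <= y ->
  lebesgue_measure [set` Interval (BSide b1 x) (BSide b2 y)] = (y - x)%:E.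
Proof.
rewrite le_eqVlt => /orP[/eqP <-|xy].
  by rewrite lebesgue_measure_itv/= lte_fin ltxx subrr.
by rewrite lebesgue_measure_itv/= lte_fin xy EFinB.
Qed.

Lemma intensity_strip_itv (b1 b2 b3 b4 : bool) (x y x' y' : R) (C : set (LipG R)) :
  measurable C -> 0 <= x -> x <= y -> 0 <= x' -> x' <= y' ->
  intensity nu (marked (strip (Interval (BSide b1 x) (BSide b2 y))
     (Interval (BSide b3 x') (BSide b4 y'))) C) =
  (((y - x) * (y' - x'))%:E * nu C)%E.
Proof.
move=> mC x0 xy x'0 xy'; apply: intensity_strip => //; try exact: itv_len.
- move=> u /=; rewrite !itv_boundlr/= => /andP[xu _]; rewrite andbT bnd_simp.
  by apply: (le_trans x0); case: b1 xu; rewrite bnd_simp// => /ltW.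
- move=> u /=; rewrite !itv_boundlr/= => /andP[xu _]; rewrite andbT bnd_simp.
  by apply: (le_trans x'0); case: b3 xu; rewrite bnd_simp// => /ltW.
Qed.

Lemma regular_points_ae : P.-negligible (~` [set w | forall n : nat,
  finite_set (S w `&` window n%:R n%:R) /\ ~ has_tie S n w]).
Proof.
have inf_negl (n : nat) :
    P.-negligible (~` [set w | finite_set (S w `&` window n%:R n%:R)]).
  have mW : measurable (window (n%:R : R) (n%:R : R) : set (Pt R)).
    by rewrite windowE; exact: measurable_strip.
  have finW : (intensity nu (window n%:R n%:R) < +oo)%E.
    rewrite windowE strip_marked_setT intensity_strip_itv//.
    by rewrite probability_setT mule1 ltry.
  have mF := measurable_finite P S _ poissonS _ mW.
  apply/negligibleP; first exact: measurableC.
  apply: (etrans (probability_setC P mF)).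
  by rewrite (finite_count_ae P S _ poissonS (intensity_ge0 nu) _ mW finW) subee.
apply: negligibleS (negligible_bigcup (fun n => negligibleU (inf_negl n)
  (has_tie_negligible P S nu poissonS n))).
by move=> w /= /existsNP[n] /not_andP[H|/contrapT H]; exists n => //; [left|right].
Qed.

Variables (n : nat) (rho C D : R).
Hypothesis n_gt0 : (0 < n)%N.
Let L := fun f : LipG R => lipL f.
Let M := fun f : LipG R => 3 * Num.max (lipL f) 1.
Let X := fun f : LipG R => M f * (1 + `|lip_fun f z0 - z0|).
Hypothesis rho_lt1 : rho < 1.
Hypothesis intL : (\int[nu]_f (L f `^ n%:R^-1)%:E = rho%:E)%E.
Hypothesis intM : (\int[nu]_f (M f `^ n%:R^-1)%:E = C%:E)%E.
Hypothesis intX : (\int[nu]_f (X f `^ n%:R^-1)%:E = D%:E)%E.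

Lemma measurable_inflated : measurable_fun [set: LipG R] M.
Proof.
apply: measurable_funM => //; apply: measurable_maxr => //.
exact: measurable_lipL.
Qed.

Lemma measurable_inflated_displacement : measurable_fun [set: LipG R] X.
Proof.
apply: measurable_funM; first exact: measurable_inflated.
by apply: measurable_funD => //; exact: measurable_displacement.
Qed.

(** Passing from the n-th roots back to the factors multiplies every exponential rate by the same n,
    which preserves the comparison of rates. *)
Lemma prod_root_le (s : seq (Pt R)) (g : LipG R -> R) (x : R) (m : nat) :
  (forall f, 0 <= g f) ->
  \prod_(p <- s) g p.2 `^ n%:R^-1 <= expR x ^+ m ->
  \prod_(p <- s) g p.2 <= expR (n%:R * x) ^+ m.
Proof.
move=> g0 H; rewrite (eq_bigr (fun p : Pt R => (g p.2 `^ n%:R^-1) ^+ n)); last first.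
  by move=> p _; rewrite root_exprn.
rewrite prodrXl expRM_natl -exprM mulnC exprM lerXn2r// nnegrE ?exprn_ge0 ?expR_ge0//.
by apply: prodr_ge0 => p _; exact: powR_ge0.
Qed.

(** For the n-th roots, the mean product over [0, a] decays at rate a (1 - rho), and the one over
    (a, b] grows at rate (b - a) (C - 1) < (b - a) C. Half of the decay is spent on Borel-Cantelli,
    hence the division by 2. *)
Lemma zeta_local_bounded_variation (a b : R) : 0 < a -> a < b ->
  (b - a) * C < a * (1 - rho) / 2 ->
  P.-negligible (~` [set w | (total_variation a b (zeta z0 (S w)) < +oo)%E]).
Proof.
move=> a0 ab abC; have b0 : 0 < b := lt_trans a0 ab.
pose u := a * (1 - rho) / 2.
have u0 : 0 < u by rewrite divr_gt0// mulr_gt0// subr_gt0.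
(* Half of the gap left by the hypothesis becomes the rate of the unit blocks, so that (b - a) C +
   th < u. *)
pose th := (u - (b - a) * C) / 2.
have th0 : 0 < th by rewrite divr_gt0// subr_gt0.
have M0 f : 0 <= M f by rewrite mulr_ge0// le_max ler01 orbT.
have X0 f : 0 <= X f by rewrite mulr_ge0// addr_ge0.
have r01 (x : R) : 0 < x -> 0 < expR (- x) < 1.
  by move=> x0; rewrite expR_gt0 -expR0 ltr_expR oppr_lt0.
have ev1 := prod_points_eventually P S nu poissonS
  (fun m => strip `[0, m%:R] `[0, a]) (fun m => (m%:R - 0) * (a - 0))
  (fun f => L f `^ n%:R^-1) rho (expR (- u)) (expR (- u)) 1.
(* The mean exp(m (b - a) (C - 1)) splits into the threshold exp((b - a) C)^m and the summable
   factor exp(-(b - a))^m. *)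
have ev2 := prod_points_eventually P S nu poissonS
  (fun m => strip `[0, m%:R] `]a, b]) (fun m => (m%:R - 0) * (b - a))
  (fun f => M f `^ n%:R^-1) C (expR ((b - a) * C)) (expR (- (b - a))) 1.
(* A unit block has intensity [b] for every m, so the mean exp(b (D - 1)) is constant and any
   positive rate [th] is enough. *)
have ev3 := prod_points_eventually P S nu poissonS
  (fun m => strip `]m%:R, m.+1%:R] `[0, b]) (fun m => (m.+1%:R - m%:R) * (b - 0))
  (fun f => X f `^ n%:R^-1) D (expR th) (expR (- th)) (expR (b * (D - 1))).
apply: (negligibleS _ (negligibleU (negligibleU (negligibleU
  (ev1 _ _ _ _ _ intL (expR_gt0 _) (r01 _ u0) ler01 _)
  (ev2 _ _ _ _ _ intM (expR_gt0 _) (r01 (b - a) _) ler01 _))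
  (ev3 _ _ _ _ _ intX (expR_gt0 _) (r01 _ th0) (expR_ge0 _) _)) regular_points_ae)).
- rewrite -!setCI; apply: subsetC => w [[[[N1 H1] [N2 H2]] [N3 H3]] reg] /=.
  have window_nat t : exists k : nat, window t b `<=` window (k%:R : R) k%:R.
    exists (maxn (Num.trunc `|t|).+1 (Num.trunc b).+1); apply: window_le.
      rewrite (le_trans (ler_norm t))// (@le_trans _ _ (Num.trunc `|t|).+1%:R)//.
        by have /andP[_ /ltW] := truncn_itv (normr_ge0 t).
      by rewrite ler_nat leq_maxl.
    rewrite (@le_trans _ _ (Num.trunc b).+1%:R)//.
      by have /andP[_ /ltW] := truncn_itv (ltW b0).
    by rewrite ler_nat leq_maxr.
  have fin t : finite_set (S w `&` window t b).
    have [k tk] := window_nat t; have [fk _] := reg k.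
    by apply: sub_finite_set fk; exact: setIS.
  have dist t p q : (S w `&` window t b) p -> (S w `&` window t b) q ->
      p.1.1 = q.1.1 -> p = q.
    move=> [Sp wp] [Sq wq] pq; apply: contrapT => npq.
    have [k tk] := window_nat t; have [_ nk] := reg k; apply: nk.
    by exists p, q; split=> //; split=> //; exact: tk.
  have ab0 : 0 < a < b by rewrite a0.
  have [|m Nm|B HB] := majorant_timeline_bounded z0 (S w) a b fin dist ab0
    (n%:R * u) (n%:R * ((b - a) * C)) (n%:R * th) (maxn N1 (maxn N2 N3)).
  + rewrite -mulrDr ltr_pM2l ?ltr0n// /th.
    by move: abC; rewrite -/u; lra.
  + move: Nm; rewrite !geq_max => /and3P[m1 m2 m3]; split.
    * by rewrite -mulrN; apply: prod_root_le; [exact: lipL_ge0|exact: H1].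
    * by apply: (prod_root_le _ M); [exact: M0|exact: H2].
    * by apply: (prod_root_le _ X); [exact: X0|exact: H3].
  + exact: zeta_bounded_variation fin dist _ ab _ HB.
- by move=> m; rewrite !subr0 mulr_ge0// ltW.
- by move=> m; exact: measurable_strip.
- by move=> m E mE; rewrite intensity_strip_itv// ltW.
- by apply: measurable_root; exact: measurable_lipL.
- by move=> f; exact: powR_ge0.
- move=> m; rewrite mul1r -expRD -expRM_natl !subr0 ler_expR.
  by rewrite le_eqVlt; apply/orP; left; apply/eqP; rewrite /u; field.
- by move=> m; rewrite subr0 mulr_ge0// subr_ge0 ltW.
- by move=> m; exact: measurable_strip.
- by move=> m E mE; rewrite intensity_strip_itv// ltW.
- by apply: measurable_root; exact: measurable_inflated.
- by move=> f; exact: powR_ge0.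
- by rewrite subr_gt0.
- move=> m; rewrite mul1r -expRD -expRM_natl !subr0 ler_expR.
  by rewrite le_eqVlt; apply/orP; left; apply/eqP; ring.
- by move=> m; apply: mulr_ge0; rewrite subr_ge0 ?ler_nat// ltW.
- by move=> m; exact: measurable_strip.
- by move=> m E mE; rewrite intensity_strip_itv ?ler_nat// ltW.
- by apply: measurable_root; exact: measurable_inflated_displacement.
- by move=> f; exact: powR_ge0.
- move=> m; rewrite -expRD subrr expR0 expr1n mulr1 ler_expR subr0 -natr1.
  by rewrite addrAC subrr add0r mul1r.
Qed.

End LocalBound.

(** * Covering an arbitrary interval *)

Lemma expr_ge_unbounded {R : realType} (q x : R) : 1 < q -> exists n : nat, x <= q ^+ n.
Proof.
move=> q1; have q0 : 0 < q - 1 by rewrite subr_gt0.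
exists (Num.trunc (`|x| / (q - 1))).+1; set n := _.+1.
rewrite (le_trans (ler_norm x))//.
have /andP[_ /ltW] := truncn_itv (divr_ge0 (normr_ge0 x) (ltW q0)).
rewrite ler_pdivrMr// => H; apply: (le_trans H).
apply: (le_trans (bernoulli_le n q _)); first by rewrite ltW// (lt_trans ltr01).
by rewrite lerBlDr lerDl.
Qed.

Theorem theorem5p4 (R : realType) (d : measure_display) (Omega : measurableType d)
    (P : probability Omega R) (nu : probability (LipG R) R) (z0 : R)
    (S : Omega -> set (Pt R)) :
  (\int[nu]_f (lipL f)%:E < +oo)%E ->
  (\int[nu]_f elog (lipL f) < 0)%E ->
  (\int[nu]_f (`|lip_fun f z0 - z0|)%:E < +oo)%E ->
  is_poisson_process P S (intensity nu) ->
  {ae P, forall w, forall a b : R, 0 < a -> a < b ->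
     (total_variation a b (zeta z0 (S w)) < +oo)%E}.
Proof.
move=> intL intlog intB poissonS.
pose L := fun f : LipG R => lipL f.
pose B := fun f : LipG R => `|lip_fun f z0 - z0|.
pose M := fun f : LipG R => 3 * Num.max (lipL f) 1.
pose X := fun f : LipG R => M f * (1 + B f).
have mL : measurable_fun [set: LipG R] L := measurable_lipL.
have mB : measurable_fun [set: LipG R] B by exact: measurable_displacement.
have mM : measurable_fun [set: LipG R] M by exact: measurable_inflated.
have mX : measurable_fun [set: LipG R] X by exact: measurable_inflated_displacement.
have L0 f : 0 <= L f by exact: lipL_ge0.
have B0 f : 0 <= B f by exact: normr_ge0.
have M1 f : 1 <= M f.
  have : 1 <= Num.max (lipL f) 1 by rewrite le_max lexx orbT.
  by rewrite /M; lra.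
have M0 f : 0 <= M f by rewrite (le_trans ler01).
have X0 f : 0 <= X f by rewrite mulr_ge0// addr_ge0.
have [e intLe] : exists e, (\int[nu]_f (L f)%:E = e%:E)%E.
  exists (fine (\int[nu]_f (L f)%:E)); rewrite fineK// ge0_fin_numE//.
  by apply: integral_ge0 => f _; rewrite lee_fin.
have [n [n1 rho1]] := exists_contracting_moment nu L e mL L0 intLe intlog.
have n0 : (0 < n)%N by exact: ltnW.
have le_expn (x : R) k : 1 <= x -> (0 < k)%N -> x <= x ^+ k.
  by move=> x1 k0; rewrite -[leLHS]expr1 ler_weXn2l.
(* One integrable function above L, M and 1 + B. Since H >= 1 and n >= 2, also X = M (1 + B) <= H^2
   <= H^n, so the n-th root of X is integrable. *)
pose H := fun f : LipG R => 4 * (1 + L f + B f).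
have H1 f : 1 <= H f by have := L0 f; have := B0 f; rewrite /H; lra.
have mH : measurable_fun [set: LipG R] H.
  apply: measurable_funM => //; apply: measurable_funD => //.
  exact: measurable_funD.
have intH : (\int[nu]_f (H f)%:E < +oo)%E.
  have mL' : measurable_fun [set: LipG R] (fun f => (L f)%:E) by exact/measurable_EFinP.
  have mB' : measurable_fun [set: LipG R] (fun f => (B f)%:E) by exact/measurable_EFinP.
  have mL1 : measurable_fun [set: LipG R] (fun f => 1 + (L f)%:E)%E.
    exact: emeasurable_funD.
  have mLB : measurable_fun [set: LipG R] (fun f => 1 + (L f)%:E + (B f)%:E)%E.
    exact: emeasurable_funD.
  have L0' f : [set: LipG R] f -> (0 <= (L f)%:E)%E by rewrite lee_fin.
  have B0' f : [set: LipG R] f -> (0 <= (B f)%:E)%E by rewrite lee_fin.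
  have L10 f : [set: LipG R] f -> (0 <= 1 + (L f)%:E)%E by rewrite -EFinD lee_fin addr_ge0.
  have LB0 f : [set: LipG R] f -> (0 <= 1 + (L f)%:E + (B f)%:E)%E.
    by rewrite -!EFinD lee_fin !addr_ge0.
  have -> : (\int[nu]_f (H f)%:E =
      \int[nu]_f (4%:E * (1 + (L f)%:E + (B f)%:E)))%E by [].
  rewrite (ge0_integralZl _ measurableT mLB LB0)//.
  rewrite lte_mul_pinfty// (ge0_integralD _ measurableT L10 mL1 B0' mB').
  rewrite lte_add_pinfty// (@ge0_integralD _ _ _ _ _ measurableT (cst 1%E))//.
  rewrite lte_add_pinfty// integral_cst// mul1e.
  by rewrite (le_lt_trans (probability_le1 _ _))// ltry.
have ML f : M f <= 3 * (1 + L f).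
  by rewrite /M ler_pM2l// ge_max lerDr ler01 lerDl L0.
have MH f : M f <= H f.
  by have := ML f; have := L0 f; have := B0 f; rewrite /H; lra.
have XH f : X f <= H f ^+ n.
  apply: (@le_trans _ _ (H f ^+ 2)); last by rewrite ler_weXn2l.
  rewrite expr2 /X ler_pM ?addr_ge0//.
  by have := L0 f; have := B0 f; rewrite /H; lra.
have H0 f : 0 <= H f by rewrite (le_trans ler01).
have [rho intrho] : exists G, (\int[nu]_f (L f `^ n%:R^-1)%:E = G%:E)%E.
  apply: (integral_root_fin nu n L H) => // f; apply: le_trans (le_expn _ _ (H1 f) n0).
  by have := L0 f; have := B0 f; rewrite /H; lra.
have [C intC] : exists G, (\int[nu]_f (M f `^ n%:R^-1)%:E = G%:E)%E.
  apply: (integral_root_fin nu n M H) => // f; exact: le_trans (le_expn _ _ (H1 f) n0).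
have [D intD] : exists G, (\int[nu]_f (X f `^ n%:R^-1)%:E = G%:E)%E.
  exact: (integral_root_fin nu n X H).
have {}rho1 : rho < 1 by rewrite -lte_fin -intrho.
(* This gives (q - 1) C <= (1 - rho) / 4, below the (1 - rho) / 2 required on [x, q x], for all x >
   0 at once. *)
pose q := 1 + (1 - rho) / (4 * (`|C| + 1)).
have C0 : 0 < `|C| + 1 by rewrite ltr_wpDl.
have q1 : 1 < q by rewrite ltrDl divr_gt0// ?subr_gt0// mulr_gt0.
have q0 : 0 < q := lt_trans ltr01 q1.
pose x (N k : nat) := q ^- N * q ^+ k.
have x0 N k : 0 < x N k by rewrite mulr_gt0// ?invr_gt0 exprn_gt0.
have xlt N k : x N k < x N k.+1.
  by rewrite /x exprS mulrCA ltr_pMl// x0.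
have local N k : P.-negligible (~` [set w |
    (total_variation (x N k) (x N k.+1) (zeta z0 (S w)) < +oo)%E]).
  apply: (zeta_local_bounded_variation P nu z0 S poissonS n rho C D n0 rho1 intrho intC intD) => //.
  have -> : x N k.+1 - x N k = x N k * ((1 - rho) / (4 * (`|C| + 1))).
    by rewrite /x exprS /q; ring.
  move: (x N k) (x0 N k) => y y0.
  rewrite -!mulrA ltr_pM2l// ltr_pM2l ?subr_gt0//.
  apply: (@le_lt_trans _ _ (4^-1)); last by rewrite ltf_pV2 ?posrE// ltr_nat.
  rewrite invfM -mulrA ler_piMr// ler_pdivrMl// mulr1.
  by rewrite (le_trans (ler_norm C))// lerDl.
(* Only countably many pairs (N, k) occur, so the null set is fixed before [a] and [b] are
   chosen. *)
apply: negligibleS (negligible_bigcup (fun N => negligible_bigcup (fun k => local N k))).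
move=> w /=; apply: contra_notP => Hw a b a0 ab.
have Hloc N k : (total_variation (x N k) (x N k.+1) (zeta z0 (S w)) < +oo)%E.
  by apply: contrapT => Hc; apply: Hw; exists N => //; exists k.
have Hchain N k : x N 0%N <= x N k /\
    (total_variation (x N 0%N) (x N k) (zeta z0 (S w)) < +oo)%E.
  elim: k => [|k [le0k ih]]; first by rewrite lexx total_variationxx ltry.
  split; first by rewrite (le_trans le0k)// ltW.
  rewrite (total_variationD _ le0k); last exact/ltW.
  exact: (lte_add_pinfty ih (Hloc N k)).
(* [N] ensures q^(-N) <= a; [k] is chosen afterwards, with q^(k - N) >= b. *)
have [N aN] := expr_ge_unbounded q a^-1 q1.
have [k bk] := expr_ge_unbounded q (b * q ^+ N) q1.
have sa : x N 0%N <= a.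
  by rewrite /x expr0 mulr1 -[leRHS]invrK lef_pV2 ?posrE ?exprn_gt0// invr_gt0.
have bt : b <= x N k by rewrite /x mulrC ler_pdivlMr// exprn_gt0.
have [_] := Hchain N k; apply: le_lt_trans.
rewrite (total_variationD _ sa); last exact: le_trans (ltW ab) bt.
rewrite (total_variationD _ (ltW ab) bt).
rewrite -[leLHS]add0e leeD// ?total_variation_ge0//.
by rewrite -[leLHS]adde0 leeD2l// total_variation_ge0.
Qed.
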